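(* Consider the problem $(P)$ and the approximate problem $(P_\Delta)$ with some $\delta>0$, both as described in the context. Suppose that the non-degeneracy, balanced communication and periodical strong connectivity assumptions on the weighted digraphs $\mathcal{G}(k)$ hold, and that Slater's condition holds for $(P)$. Consider the dual sequences $\{\mu_i(k)\}$, $\{\lambda^i(k)\}$, $\{w^i(k)\}$ and the primal sequences $\{x_i(k)\}$, $i\in V$, generated by the Distributed Approximate Dual Subgradient (DADS) algorithm described in the context, with step-sizes $\alpha(k)\ge 0$ satisfying $$\lim_{k\to+\infty}\alpha(k)=0,\qquad \sum_{k=0}^{+\infty}\alpha(k)=+\infty,\qquad \sum_{k=0}^{+\infty}\alpha(k)^2<+\infty .$$ (1) (Dual estimate convergence) There exists a dual optimal solution $\xi^*=(\mu^*,\lambda^*,w^* )\in D^*_\Delta$, with $\mu^*=(\mu_i^* )_{i\in V}$, such that for all $i\in V$: $$\lim_{k\to+\infty}\|\mu_i(k)-\mu_i^*\|=0,\qquad \lim_{k\to+\infty}\|\lambda^i(k)-\lambda^*\|=0,\qquad \lim_{k\to+\infty}\|w^i(k)-w^*\|=0 .$$ (2) (Primal estimate convergence) If this dual solution satisfies $\xi^*\in D_s^*$, i.e. $\Omega_i(\xi_i^* )$ is a singleton for every $i\in V$, where $\xi_i^*:=(\mu_i^*,\lambda^*,w^* )$, then there is $x^*=(x_i^* )_{i\in V}\in X^*_\Delta$ such that, for all $i\in V$: $$\lim_{k\to+\infty}\|x_i(k)-x_i^*\|=0 .$$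
   Context: **Problem.** Let $V=\{1,\dots,N\}$ be a set of agents. For $i\in V$ let $f_i:\mathbb{R}^n\to\mathbb{R}$ be continuous, let $g:\mathbb{R}^n\to\mathbb{R}^m$ be continuous, and let $X\subseteq\mathbb{R}^n$ be compact (no convexity is assumed). Problem $(P)$ is: minimize $\sum_{i\in V}f_i(z)$ over $z\in\mathbb{R}^n$ subject to $g(z)\le 0$ (componentwise) and $z\in X$. The feasible set of $(P)$ is non-empty. Slater's condition: there is $\bar z\in X$ with $g(\bar z)<0$ componentwise; such a $\bar z$ is called a Slater vector, and one fixed Slater vector $\bar z$ is known to all agents. **Approximate problem.** Fix a directed cycle on $V$ (with $N$ edges) in which each agent $i$ has a unique out-neighbor $i_D$ and a unique in-neighbor $i_U$. For $\delta>0$ let $\Delta:=\delta\mathbf{1}\in\mathbb{R}^n$, where $\mathbf 1$ is the all-ones vector. Problem $(P_\Delta)$ is: minimize $\sum_{i\in V}f_i(x_i)$ over $(x_i)_{i\in V}\in\mathbb{R}^{nN}$ subject to, for all $i\in V$, $g(x_i)\le 0$, $-x_i+x_{i_D}-\Delta\le 0$, $x_i-x_{i_D}-\Delta\le 0$, $x_i\in X$. Its set of optimal solutions is $X^*_\Delta$. **Dual.** Let $\Xi:=\mathbb{R}^{mN}_{\ge0}\times\mathbb{R}^{nN}_{\ge0}\times\mathbb{R}^{nN}_{\ge0}$ and $\Xi':=\mathbb{R}^{m}_{\ge0}\times\mathbb{R}^{nN}_{\ge0}\times\mathbb{R}^{nN}_{\ge0}$. For $\xi=(\mu,\lambda,w)\in\Xi$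 with $\mu=(\mu_i)$, $\lambda=(\lambda_i)$, $w=(w_i)$, write $\xi_i:=(\mu_i,\lambda,w)\in\Xi'$. The dual function is $$Q(\xi):=\inf_{x\in X^N}\sum_{i\in V}\big(f_i(x_i)+\langle\mu_i,g(x_i)\rangle+\langle\lambda_i,-x_i+x_{i_D}-\Delta\rangle+\langle w_i,x_i-x_{i_D}-\Delta\rangle\big),$$ the dual problem $(D_\Delta)$ is to maximize $Q$ over $\Xi$, and $D^*_\Delta$ is its set of optimal solutions. The local Lagrangian is $$\mathcal{L}_i(x_i,\xi_i):=f_i(x_i)+\langle\mu_i,g(x_i)\rangle+\langle-\lambda_i+\lambda_{i_U},x_i\rangle+\langle w_i-w_{i_U},x_i\rangle-\langle\lambda_i,\Delta\rangle-\langle w_i,\Delta\rangle .$$ The marginal map is $\Omega_i(\xi_i):=\operatorname{argmin}_{x_i\in X}\mathcal{L}_i(x_i,\xi_i)$. $D_s^*$ is the set of $\xi=(\mu,\lambda,w)$ such that $\Omega_i(\xi_i)$ is a singleton for each $i\in V$. **Network.** At each time $k\ge0$ there is a weighted digraph $\mathcal{G}(k)=(V,E(k),A(k))$ with $A(k)=[a^i_j(k)]\in\mathbb{R}^{N\times N}$, where $a^i_j(k)\ge0$ is the weight of edge $(j,i)$ from $j$ to $i$ and $E(k)\subseteq V\times V\setminus\operatorname{diag}(V)$ is the set of edges with non-zero weight. Non-degeneracy: there is a constant $\alpha>0$ with $a^i_i(k)\ge\alpha$ and $a^i_j(k)\in\{0\}\cup[\alpha,1]$ for $i\ne j$, for all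 $k\ge0$. Balanced communication: $\sum_{j\in V}a^i_j(k)=1$ for all $i\in V,k\ge0$, and $\sum_{i\in V}a^i_j(k)=1$ for all $j\in V,k\ge0$. Periodical strong connectivity: there is a positive integer $B$ such that for all $k_0\ge0$ the digraph $(V,\bigcup_{k=0}^{B-1}E(k_0+k))$ is strongly connected. **DADS algorithm.** Let $\beta(\bar z):=\min\{\min_{1\le\ell\le m}(-g_\ell(\bar z)),\delta\}$, $\gamma_i(\bar z):=\big(f_i(\bar z)-\inf_{x_i\in X}f_i(x_i)\big)/\beta(\bar z)$, $\gamma:=N\max_{i\in V}\gamma_i(\bar z)$, and $M_i:=\{\xi_i\in\Xi' : \|\xi_i\|\le\gamma+\theta_i\}$ for some $\theta_i>0$; $P_{M_i}$ is the Euclidean projection onto the closed convex set $M_i$. Agent $i$ maintains $x_i(k)\in\mathbb{R}^n$ and $\xi_i(k)=(\mu_i(k),\lambda^i(k),w^i(k))\in\Xi'$, with arbitrary initial $x_i(0)\in X$ and $\xi_i(0)\in\Xi'$. Set $v^i_\lambda(k):=\sum_{j\in V}a^i_j(k)\lambda^j(k)$, $v^i_w(k):=\sum_{j\in V}a^i_j(k)w^j(k)$, $v_i(k):=(\mu_i(k),v^i_\lambda(k),v^i_w(k))\in\Xi'$. Let $\mathcal{D}_i(k):=(\mathcal{D}^i_\mu(k),\mathcal{D}^i_\lambda(k),\mathcal{D}^i_w(k))$ where $\mathcal{D}^i_\mu(k):=g(x_i(k))$; $\mathcal{D}^i_\lambda(k)\in\mathbb{R}^{nN}$ has blocks $\mathcal{D}^i_\lambda(k)_i:=-\Delta-x_i(k)$,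 $\mathcal{D}^i_\lambda(k)_{i_U}:=x_i(k)$, and $0$ for all other indices; $\mathcal{D}^i_w(k)\in\mathbb{R}^{nN}$ has blocks $\mathcal{D}^i_w(k)_i:=-\Delta+x_i(k)$, $\mathcal{D}^i_w(k)_{i_U}:=-x_i(k)$, and $0$ for all other indices. At each time $k$: for $k\ge1$, choose any $x_i(k)\in\Omega_i(v_i(k))$; for $k\ge0$, set $\xi_i(k+1)=P_{M_i}[v_i(k)+\alpha(k)\mathcal{D}_i(k)]$, with step-size $\alpha(k)\ge0$. All norms are Euclidean. *)

(* Defs.v *)
From HB Require Import structures.
From mathcomp Require Import all_boot all_order all_algebra all_fingroup.
From mathcomp Require Import all_classical all_reals all_analysis.

Set Implicit Arguments.
Unset Strict Implicit.
Unset Printing Implicit Defensive.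

Import Order.TTheory GRing.Theory Num.Theory.
Import numFieldNormedType.Exports.

Local Open Scope classical_set_scope.
Local Open Scope ring_scope.

(* Points of R^n are row vectors; a point of R^(pN) is an N x p matrix whose  *)
(* i-th row is the i-th block.  The library topology on matrices is the usual *)
(* one, but the library norm is the sup norm, so the Euclidean norm is        *)
(* defined here.                                                              *)
Definition dotp {R : realType} {p : nat} (u v : 'rV[R]_p) : R :=
  \sum_(j < p) u 0 j * v 0 j.

Definition sqnorm {R : realType} {p q : nat} (M : 'M[R]_(p, q)) : R :=
  \sum_(i < p) \sum_(j < q) M i j ^+ 2.

Definition norm2 {R : realType} {p q : nat} (M : 'M[R]_(p, q)) : R :=
  Num.sqrt (sqnorm M).

Definition le0v {R : realType} {p : nat} (u : 'rV[R]_p) : Prop :=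
  forall j : 'I_p, u 0 j <= 0.

Definition lt0v {R : realType} {p : nat} (u : 'rV[R]_p) : Prop :=
  forall j : 'I_p, u 0 j < 0.

Definition argmin {R : realType} {T : Type} (S : set T) (F : T -> R) : set T :=
  [set x | S x /\ forall y, S y -> F x <= F y].

Definition argmax {R : realType} {T : Type} (S : set T) (F : T -> R) : set T :=
  [set x | S x /\ forall y, S y -> F y <= F x].

Definition feasible {R : realType} {n m : nat} (g : 'rV[R]_n -> 'rV[R]_m)
    (X : set 'rV[R]_n) : set 'rV[R]_n :=
  [set z | le0v (g z) /\ X z].

Definition slater_vector {R : realType} {n m : nat}
    (g : 'rV[R]_n -> 'rV[R]_m) (X : set 'rV[R]_n) (z : 'rV[R]_n) : Prop :=
  X z /\ lt0v (g z).

(* The directed cycle on V = 'I_N is a permutation s with a single orbit: s i *)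
(* is the out-neighbor of i.                                                  *)
Definition is_cycle {N : nat} (s : {perm 'I_N}) : Prop :=
  forall i j : 'I_N, j \in porbit s i.

Definition outn {N : nat} (s : {perm 'I_N}) (i : 'I_N) : 'I_N := s i.

Definition inn {N : nat} (s : {perm 'I_N}) (i : 'I_N) : 'I_N := (s^-1)%g i.

Definition Delta {R : realType} {n : nat} (delta : R) : 'rV[R]_n :=
  const_mx delta.

Definition feasibleD {R : realType} {N n m : nat} (g : 'rV[R]_n -> 'rV[R]_m)
    (X : set 'rV[R]_n) (s : {perm 'I_N}) (delta : R) : set 'M[R]_(N, n) :=
  [set x | forall i : 'I_N,
    [/\ le0v (g (row i x)),
        le0v (- row i x + row (outn s i) x - Delta delta),
        le0v (row i x - row (outn s i) x - Delta delta) &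
        X (row i x)]].

(* X^*_Delta *)
Definition primal_opt {R : realType} {N n m : nat}
    (f : 'I_N -> 'rV[R]_n -> R) (g : 'rV[R]_n -> 'rV[R]_m)
    (X : set 'rV[R]_n) (s : {perm 'I_N}) (delta : R) : set 'M[R]_(N, n) :=
  argmin (feasibleD g X s delta) (fun x => \sum_(i < N) f i (row i x)).

(* The ambient spaces of Xi, with xi = (mu, lambda, w), and of Xi', with      *)
(* xi_i = (mu_i, lambda, w).                                                  *)
Definition gdual (R : realType) (N n m : nat) : Type :=
  ('M[R]_(N, m) * 'M[R]_(N, n) * 'M[R]_(N, n))%type.

Definition ldual (R : realType) (N n m : nat) : Type :=
  ('rV[R]_m * 'M[R]_(N, n) * 'M[R]_(N, n))%type.

Definition Xi {R : realType} {N n m : nat} : set (gdual R N n m) :=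
  [set xi | [/\ xi.1.1 \is a mxOver Num.nneg, xi.1.2 \is a mxOver Num.nneg &
                xi.2 \is a mxOver Num.nneg]].

Definition Xi' {R : realType} {N n m : nat} : set (ldual R N n m) :=
  [set xi | [/\ xi.1.1 \is a mxOver Num.nneg, xi.1.2 \is a mxOver Num.nneg &
                xi.2 \is a mxOver Num.nneg]].

Definition local {R : realType} {N n m : nat} (xi : gdual R N n m)
    (i : 'I_N) : ldual R N n m :=
  (row i xi.1.1, xi.1.2, xi.2).

Definition lnorm {R : realType} {N n m : nat} (xi : ldual R N n m) : R :=
  Num.sqrt (sqnorm xi.1.1 + sqnorm xi.1.2 + sqnorm xi.2).

Definition lagrangian {R : realType} {N n m : nat}
    (f : 'I_N -> 'rV[R]_n -> R) (g : 'rV[R]_n -> 'rV[R]_m)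
    (s : {perm 'I_N}) (delta : R) (x : 'M[R]_(N, n)) (xi : gdual R N n m) : R :=
  \sum_(i < N)
    (f i (row i x) + dotp (row i xi.1.1) (g (row i x))
     + dotp (row i xi.1.2) (- row i x + row (outn s i) x - Delta delta)
     + dotp (row i xi.2) (row i x - row (outn s i) x - Delta delta)).

(* The infimum is finite when X is nonempty and compact and f, g are          *)
(* continuous; inf has no meaning otherwise.                                  *)
Definition dual_fun {R : realType} {N n m : nat}
    (f : 'I_N -> 'rV[R]_n -> R) (g : 'rV[R]_n -> 'rV[R]_m)
    (X : set 'rV[R]_n) (s : {perm 'I_N}) (delta : R) (xi : gdual R N n m) : R :=
  inf [set lagrangian f g s delta x xi |
       x in [set x : 'M[R]_(N, n) | forall i, X (row i x)]].

(* D^*_Delta *)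
Definition dual_opt {R : realType} {N n m : nat}
    (f : 'I_N -> 'rV[R]_n -> R) (g : 'rV[R]_n -> 'rV[R]_m)
    (X : set 'rV[R]_n) (s : {perm 'I_N}) (delta : R) : set (gdual R N n m) :=
  argmax Xi (dual_fun f g X s delta).

Definition local_lagrangian {R : realType} {N n m : nat}
    (f : 'I_N -> 'rV[R]_n -> R) (g : 'rV[R]_n -> 'rV[R]_m)
    (s : {perm 'I_N}) (delta : R) (i : 'I_N) (x : 'rV[R]_n)
    (xi : ldual R N n m) : R :=
  let: (mu, la, w) := xi in
  f i x + dotp mu (g x)
  + dotp (- row i la + row (inn s i) la) x
  + dotp (row i w - row (inn s i) w) x
  - dotp (row i la) (Delta delta) - dotp (row i w) (Delta delta).

(* Omega_i *)
Definition marginal {R : realType} {N n m : nat}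
    (f : 'I_N -> 'rV[R]_n -> R) (g : 'rV[R]_n -> 'rV[R]_m)
    (X : set 'rV[R]_n) (s : {perm 'I_N}) (delta : R) (i : 'I_N)
    (xi : ldual R N n m) : set 'rV[R]_n :=
  argmin X (fun x => local_lagrangian f g s delta i x xi).

(* D_s^* *)
Definition dual_single {R : realType} {N n m : nat}
    (f : 'I_N -> 'rV[R]_n -> R) (g : 'rV[R]_n -> 'rV[R]_m)
    (X : set 'rV[R]_n) (s : {perm 'I_N}) (delta : R) : set (gdual R N n m) :=
  [set xi | forall i : 'I_N,
    exists x : 'rV[R]_n, marginal f g X s delta i (local xi i) = [set x]].

(* A i j is the weight a^i_j of the edge (j, i), from j to i. *)
Definition nondegenerate_weights {R : realType} {N : nat} (A : nat -> 'M[R]_N) : Prop :=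
  exists2 alpha : R, 0 < alpha & forall k : nat,
    (forall i, alpha <= A k i i) /\
    (forall i j, i != j -> A k i j = 0 \/ alpha <= A k i j <= 1).

Definition balanced_weights {R : realType} {N : nat} (A : nat -> 'M[R]_N) : Prop :=
  forall k : nat, (forall i, \sum_(j < N) A k i j = 1) /\
                  (forall j, \sum_(i < N) A k i j = 1).

Definition edge {R : realType} {N : nat} (A : 'M[R]_N) : rel 'I_N :=
  [rel j i | (j != i) && (A i j != 0)].

Definition strongly_connected {N : nat} (e : rel 'I_N) : Prop :=
  forall i j : 'I_N, connect e i j.

Definition periodically_connected {R : realType} {N : nat}
    (A : nat -> 'M[R]_N) : Prop :=
  exists2 B : nat, (0 < B)%N & forall k0 : nat,
    strongly_connected [rel j i | [exists k : 'I_B, edge (A (k0 + k)%N) j i]].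

(* Taking delta as the unit of the iterated minimum makes this                *)
(* min {min_l (- g_l z), delta}.                                              *)
Definition beta {R : realType} {n m : nat} (g : 'rV[R]_n -> 'rV[R]_m)
    (delta : R) (z : 'rV[R]_n) : R :=
  \big[Num.min/delta]_(l < m) (- g z 0 l).

Definition gammai {R : realType} {N n m : nat} (f : 'I_N -> 'rV[R]_n -> R)
    (g : 'rV[R]_n -> 'rV[R]_m) (X : set 'rV[R]_n) (delta : R) (z : 'rV[R]_n)
    (i : 'I_N) : R :=
  (f i z - inf (f i @` X)) / beta g delta z.

(* The gammai are nonnegative when z is a Slater vector, so the unit 0 of the *)
(* iterated maximum is harmless.                                              *)
Definition gamma {R : realType} {N n m : nat} (f : 'I_N -> 'rV[R]_n -> R)
    (g : 'rV[R]_n -> 'rV[R]_m) (X : set 'rV[R]_n) (delta : R)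
    (z : 'rV[R]_n) : R :=
  N%:R * \big[Num.max/0]_(i < N) gammai f g X delta z i.

Definition dual_ball {R : realType} {N n m : nat} (r : R) :
    set (ldual R N n m) :=
  [set xi | Xi' xi /\ lnorm xi <= r].

Definition is_proj {R : realType} {N n m : nat} (M : set (ldual R N n m))
    (v p : ldual R N n m) : Prop :=
  argmin M (fun q => lnorm (v - q)) p.

(* v_i *)
Definition mix {R : realType} {N n m : nat} (A : 'M[R]_N)
    (xi : 'I_N -> ldual R N n m) (i : 'I_N) : ldual R N n m :=
  ((xi i).1.1, \sum_(j < N) A i j *: (xi j).1.2,
   \sum_(j < N) A i j *: (xi j).2).

(* D_i.  The blocks i and inn s i are distinct as soon as N >= 2; for N = 1   *)
(* the two contributions to the only block are added.                         *)
Definition direction {R : realType} {N n m : nat} (g : 'rV[R]_n -> 'rV[R]_m)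
    (s : {perm 'I_N}) (delta : R) (i : 'I_N) (x : 'rV[R]_n) : ldual R N n m :=
  (g x,
   \matrix_(j < N) ((if j == i then - Delta delta - x else 0)
                    + (if j == inn s i then x else 0)),
   \matrix_(j < N) ((if j == i then - Delta delta + x else 0)
                    + (if j == inn s i then - x else 0))).

(* (x, xi) is a sequence of iterates of the algorithm. *)
Definition DADS {R : realType} {N n m : nat}
    (f : 'I_N -> 'rV[R]_n -> R) (g : 'rV[R]_n -> 'rV[R]_m)
    (X : set 'rV[R]_n) (s : {perm 'I_N}) (delta : R) (A : nat -> 'M[R]_N)
    (zbar : 'rV[R]_n) (theta : 'I_N -> R) (step : nat -> R)
    (x : nat -> 'I_N -> 'rV[R]_n) (xi : nat -> 'I_N -> ldual R N n m) : Prop :=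
  [/\ forall i, X (x 0%N i),
      forall i, Xi' (xi 0%N i),
      forall k i, (0 < k)%N ->
        marginal f g X s delta i (mix (A k) (xi k) i) (x k i) &
      forall k i,
        is_proj (dual_ball (gamma f g X delta zbar + theta i))
          (mix (A k) (xi k) i + step k *: direction g s delta i (x k i))
          (xi k.+1 i)].

(* Main.v *)
Require Import Defs.
From HB Require Import structures.
From mathcomp Require Import all_boot all_order all_algebra all_fingroup.
From mathcomp Require Import all_classical all_reals all_analysis.
From mathcomp Require Import ring lra.
Import Order.TTheory GRing.Theory Num.Theory.
Import numFieldNormedType.Exports.
Local Open Scope classical_set_scope.
Local Open Scope ring_scope.

(** Read agent [i]'s multipliers as a point [y i] of a Euclidean space whose
    coordinates are either private (the [mu]-part) or shared (the [lambda]- and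
    [w]-parts).  One iteration averages the shared coordinates with a doubly
    stochastic matrix, moves along a supergradient of the agent's concave local
    dual function, and projects.  Every dual optimum [z] lies in every projection
    ball: comparing [Q 0 <= Q z] with the value of the Lagrangian at the Slater
    vector bounds the sum of the multipliers ([slater_dual_bound]).  Hence [z] can
    serve as a test point in all the projection inequalities, and the squared
    distance [S k] from the iterates to [z] satisfies
      [S (k+1) + c (G k + E k) + 2 step_k gap_k
         <= S k + eps d k + (C0 / eps + C0) step_k^2]
    for every [eps > 0] ([projected_step_descent]).  Here [G] is the Dirichlet
    form of the weights, which up to a constant bounds from below the variance
    removed by averaging; [E] is the squared projection error, [gap] the distance
    in value of the point [zeta k], which carries the private parts of all agents
    and the shared part of one of them, from the dual optimum, and [d] the
    disagreement with that agent.

    An agent's projection ball constrains its private and shared parts together,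
    and mixing replaces the shared part only, so that the mixed point may lie
    outside the ball and the projection error need not be of the order of the
    step-size.  These errors are controlled by the same inequality:
    joint connectivity bounds [d k] by [G + E + C0 step^2] summed over a window of
    length [B] ([disagreement_window]), so that for small [eps] the loss [eps d]
    is absorbed by the gain [c (G + E)], and [d] and [step * gap] are summable
    ([perturbed_descent]).  As the steps are not summable, [gap] is small
    infinitely often; by compactness and upper semicontinuity of the dual function
    a cluster point [p] of [zeta] is a dual optimum ([gdual_cluster],
    [dual_fun_usc]).  The descent inequality with [z := p] says that the distance
    to [p] increases by summable amounts only, and it is arbitrarily small
    infinitely often, so it tends to [0] ([quasi_decreasing_cvg0],
    [dual_convergence]).

    For the primal part, unique minimizers of a continuous function on a compact
    set are stable under small perturbations ([minimizer_stable]); this gives the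
    convergence of [x_i(k)].  It also shows that the dual function is
    differentiable at [p]: moving from [p] towards another multiplier and using
    the optimality of [p], one finds that the minimizer [x] and [p] form a
    saddle point of the Lagrangian ([unique_marginal_saddle]).  Saddle points
    yield primal optima without any convexity ([saddle_primal_opt]). *)

Set Implicit Arguments.
Unset Strict Implicit.
Unset Printing Implicit Defensive.

(** * Weighted means and scalar recursions *)

(** The bias-variance decomposition of a weighted mean. *)
Lemma weighted_variance (R : realFieldType) (I : finType) (w y : I -> R) (z : R) :
  \sum_j w j = 1 ->
  \sum_j w j * (y j - z) ^+ 2 =
  (\sum_j w j * y j - z) ^+ 2 + \sum_j w j * (y j - \sum_l w l * y l) ^+ 2.
Proof.
move=> w1; set m := \sum_l w l * y l.
have E (t : R) : \sum_j w j * (y j - t) ^+ 2 =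
    \sum_j w j * y j ^+ 2 - 2 * t * m + t ^+ 2.
  rewrite -[X in _ = _ + X]mulr1 -{2}w1 /m !mulr_sumr -sumrB -big_split /=.
  by apply: eq_bigr => j _; ring.
by rewrite !E; ring.
Qed.

Lemma weighted_jensen (R : realFieldType) (I : finType) (w y : I -> R) (z : R) :
  (forall j, 0 <= w j) -> \sum_j w j = 1 ->
  (\sum_j w j * y j - z) ^+ 2 <= \sum_j w j * (y j - z) ^+ 2.
Proof.
move=> w0 w1; rewrite weighted_variance// lerDl sumr_ge0// => j _.
by rewrite mulr_ge0// sqr_ge0.
Qed.

(** The variance controls the squared distances to the value at any index [i] of
    weight at least [a]: the decomposition above, centred at [y i], has bias term
    [(m - y i)^2], which is at most the variance divided by [a]. *)
Lemma variance_ge_spread (R : realFieldType) (I : finType) (w y : I -> R) (a : R) (i : I) :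
  (forall j, 0 <= w j) -> \sum_j w j = 1 -> 0 < a -> a <= w i ->
  a / (1 + a) * (\sum_j w j * (y j - y i) ^+ 2)
    <= \sum_j w j * (y j - \sum_l w l * y l) ^+ 2.
Proof.
move=> w0 w1 a0 ai; rewrite (weighted_variance y (y i) w1).
set m := \sum_l w l * y l; set V := \sum_j w j * (y j - m) ^+ 2.
have mV : a * (m - y i) ^+ 2 <= V.
  rewrite /V (bigD1 i)//= (le_trans (y := w i * (y i - m) ^+ 2))//.
    by rewrite -(sqrrN (y i - m)) opprB ler_wpM2r// sqr_ge0.
  by rewrite lerDl sumr_ge0// => j _; rewrite mulr_ge0// sqr_ge0.
by rewrite mulrAC ler_pdivrMr ?addr_gt0//; lra.
Qed.

(** Row sums give the variance decomposition of each mean, column sums allow the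
    squared distances to [z] to be added up again; the variance that is lost
    is bounded below by the Dirichlet form of [A]. *)
Lemma doubly_stochastic_contraction (R : realFieldType) (N : nat) (A : 'M[R]_N)
    (a : R) (y : 'I_N -> R) (z : R) :
  (forall i j, 0 <= A i j) -> (forall i, \sum_j A i j = 1) ->
  (forall j, \sum_i A i j = 1) -> 0 < a -> (forall i, a <= A i i) ->
  \sum_i (\sum_j A i j * y j - z) ^+ 2
    + a / (1 + a) * (\sum_i \sum_j A i j * (y j - y i) ^+ 2)
  <= \sum_i (y i - z) ^+ 2.
Proof.
move=> A0 Ar Ac a0 aA.
have -> : \sum_i (y i - z) ^+ 2 = \sum_i \sum_j A i j * (y j - z) ^+ 2.
  by rewrite exchange_big; apply: eq_bigr => j _ /=; rewrite -mulr_suml Ac mul1r.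
rewrite mulr_sumr -big_split; apply: ler_sum => i _ /=.
by rewrite (weighted_variance y z (Ar i)) lerD2l variance_ge_spread.
Qed.

Lemma path_dist (R : realFieldType) (T : eqType) (e : rel T) (u : T -> R) (rho : R) :
  (forall x y, e x y -> `|u x - u y| <= rho) ->
  forall p x, path e x p -> `|u x - u (last x p)| <= (size p)%:R * rho.
Proof.
move=> urho; elim=> [|y p IH] x /=; first by rewrite subrr normr0 mul0r.
move=> /andP[exy yp]; rewrite -natr1 mulrDl mul1r [leRHS]addrC.
by apply: le_trans (ler_distD (u y) _ _) _; rewrite lerD ?urho ?IH.
Qed.

(** A path without repetition has fewer than [#|T|] edges. *)
Lemma connect_dist (R : realFieldType) (T : finType) (e : rel T) (u : T -> R) (rho : R) :
  0 <= rho -> (forall x y, e x y -> `|u x - u y| <= rho) ->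
  forall x y, connect e x y -> `|u x - u y| <= #|T|%:R * rho.
Proof.
move=> rho0 urho x y /connectP[p xp ->].
case/shortenP: xp => q xq uq _.
rewrite (le_trans (path_dist urho xq))// ler_wpM2r// ler_nat.
by rewrite (leq_trans _ (max_card [in x :: q]))// (card_uniqP uq) /= ltnW.
Qed.

Lemma sum_window (R : numDomainType) (h : nat -> R) (B K : nat) :
  (forall k, 0 <= h k) ->
  \sum_(k < K) \sum_(s < B) h (k + s)%N <= B%:R * \sum_(k < K + B) h k.
Proof.
move=> h0; rewrite exchange_big /=.
rewrite mulr_natl -[X in _ *+ X]card_ord -sumr_const; apply: ler_sum => s _.
have -> : (K + B)%N = (s + K + (B - s))%N.
  by rewrite addnAC (subnKC (ltnW (ltn_ord s))) addnC.
rewrite big_split_ord /= big_split_ord /=.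
under eq_bigr do rewrite addnC.
by rewrite -addrA addrCA lerDl addr_ge0// sumr_ge0.
Qed.

(** The gain [c * h] pays for the loss [eps * d] once [eps] is of the order of
    [c / (C1 * B)], because the sum of [d] is at most [C1 * B] times that of [h],
    up to the last [B] terms.  These are bounded in advance, again by the descent
    inequality, as [S] and [d] are bounded. *)
Lemma perturbed_descent (R : realFieldType) (S h d a gap : nat -> R)
    (c C0 C1 Smax dmax sa : R) (B : nat) :
  0 < c -> 0 <= C0 -> 0 < C1 -> (0 < B)%N ->
  (forall k, 0 <= S k <= Smax) -> (forall k, 0 <= d k <= dmax) ->
  (forall k, 0 <= h k) -> (forall k, 0 <= a k) -> (forall k, 0 <= gap k) ->
  (forall K, \sum_(k < K) a k ^+ 2 <= sa) ->
  (forall (eps : R) k, 0 < eps ->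
     S k.+1 + c * h k + 2 * a k * gap k
       <= S k + eps * d k + (C0 / eps + C0) * a k ^+ 2) ->
  (forall k, d k <= C1 * \sum_(s < B) (h (k + s)%N + C0 * a (k + s)%N ^+ 2)) ->
  exists M : R, forall K,
    \sum_(k < K) d k <= M /\ \sum_(k < K) a k * gap k <= M.
Proof.
move=> c0 C00 C10 B0 SS dd h0 a0 g0 aS descent dwin.
have B0' : 0 < B%:R :> R by rewrite ltr0n.
(* With this eps the loss eps * sum d uses up half of the gain c * sum h. *)
pose eps := c / (2 * (C1 * B%:R)).
have CB0 : 0 < C1 * B%:R by rewrite mulr_gt0.
have eps0 : 0 < eps by rewrite divr_gt0// mulr_gt0.
have epsE : eps * (C1 * B%:R) = c / 2.
  by rewrite /eps; field; rewrite gt_eqF//= gt_eqF.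
pose Keps := C0 / eps + C0.
have K0 : 0 <= Keps by rewrite addr_ge0// divr_ge0// ltW.
have sa0 : 0 <= sa by have := aS 0%N; rewrite big_ord0.
have asa k : a k ^+ 2 <= sa.
  apply: le_trans (aS k.+1); rewrite big_ord_recr /= lerDr.
  by rewrite sumr_ge0// => i _; rewrite sqr_ge0.
pose hmax := (Smax + eps * dmax + Keps * sa) / c.
have hh k : h k <= hmax.
  rewrite /hmax ler_pdivlMr// mulrC.
  have := descent _ k eps0; rewrite -/Keps.
  have /andP[S0 _] := SS k.+1; have /andP[_ S1] := SS k.
  have /andP[_ d1] := dd k.
  have : eps * d k <= eps * dmax by rewrite ler_wpM2l// ltW.
  have : Keps * a k ^+ 2 <= Keps * sa by rewrite ler_wpM2l.
  have : 0 <= 2 * a k * gap k by rewrite !mulr_ge0.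
  lra.
pose H K := \sum_(k < K) h k; pose P K := \sum_(k < K) a k * gap k.
pose D K := \sum_(k < K) d k.
have HB K : H (K + B)%N <= H K + B%:R * hmax.
  rewrite /H big_split_ord /= lerD2l mulr_natl -[X in _ *+ X]card_ord -sumr_const.
  exact: ler_sum.
have DK K : D K <= C1 * B%:R * (H K + B%:R * hmax + C0 * sa).
  have h'0 k : 0 <= h k + C0 * a k ^+ 2 by rewrite addr_ge0// mulr_ge0// sqr_ge0.
  have := sum_window B K h'0; rewrite big_split -mulr_sumr /= => wB.
  have : D K <= \sum_(k < K) C1 * \sum_(s < B) (h (k + s)%N + C0 * a (k + s)%N ^+ 2).
    exact: ler_sum.
  move=> /le_trans; apply; rewrite -mulr_sumr -mulrA ler_pM2l//; apply: le_trans wB _.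
  rewrite ler_pM2l//; apply: lerD; [exact: HB | apply: ler_wpM2l => //; exact: aS].
have tele K : S K + c * H K + 2 * P K <= S 0%N + eps * D K + Keps * sa.
  suff : S K + c * H K + 2 * P K <= S 0%N + eps * D K + Keps * \sum_(k < K) a k ^+ 2.
    by move=> /le_trans; apply; rewrite lerD2l ler_wpM2l.
  rewrite /H /P /D; elim: K => [|K IH]; first by rewrite !big_ord0 !mulr0 !addr0.
  rewrite !big_ord_recr /=.
  by have := descent _ K eps0; rewrite -/Keps; lra.
pose T := S 0%N + c / 2 * (B%:R * hmax + C0 * sa) + Keps * sa.
have key K : c / 2 * H K + 2 * P K <= T.
  have := tele K; have /andP[S0 _] := SS K.
  have : eps * D K <= c / 2 * (H K + B%:R * hmax + C0 * sa).
    by rewrite -epsE -mulrA ler_pM2l.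
  rewrite /T; lra.
have H0 K : 0 <= H K by rewrite sumr_ge0.
have P0 K : 0 <= P K by rewrite sumr_ge0// => k _; rewrite mulr_ge0.
have HT K : H K <= 2 * T / c.
  rewrite ler_pdivlMr//; have := key K; have := P0 K; lra.
pose MD := C1 * B%:R * (2 * T / c + B%:R * hmax + C0 * sa).
have DM K : D K <= MD.
  by apply: le_trans (DK K) _; rewrite ler_pM2l// !lerD2r.
have T0 : 0 <= T.
  by have := key 0%N; rewrite /H /P !big_ord0 !mulr0 addr0.
have PM K : P K <= T.
  have : 0 <= c * H K by rewrite (mulr_ge0 (ltW c0)).
  by have := key K; have := P0 K; lra.
have MD0 : 0 <= MD by have := DM 0%N; rewrite /D big_ord0.
exists (MD + T) => K; split.
  by apply: le_trans (DM K) _; rewrite lerDl.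
by apply: le_trans (PM K) _; rewrite lerDr.
Qed.

(** * Averaging with doubly stochastic weights *)

Definition sqdist {R : realFieldType} {I C : finType} (y z : I -> C -> R) : R :=
  \sum_i \sum_c (y i c - z i c) ^+ 2.

(** The shared coordinates, those in [sh], are averaged; the others are private. *)
Definition average {R : realFieldType} {N : nat} {C : finType} (sh : pred C)
    (A : 'M[R]_N) (y : 'I_N -> C -> R) (i : 'I_N) (c : C) : R :=
  if sh c then \sum_j A i j * y j c else y i c.

(** The shared coordinates of all agents are replaced by those of agent [i0], which
    makes the family consensual; agent [i0] plays the role usually given to the
    mean of all agents. *)
Definition reference {R : realFieldType} {N : nat} {C : finType} (sh : pred C)
    (i0 : 'I_N) (y : 'I_N -> C -> R) (i : 'I_N) (c : C) : R :=
  if sh c then y i0 c else y i c.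

(** The Dirichlet form of [A] on the shared coordinates. *)
Definition spread {R : realFieldType} {N : nat} {C : finType} (sh : pred C)
    (A : 'M[R]_N) (y : 'I_N -> C -> R) : R :=
  \sum_(c | sh c) \sum_i \sum_j A i j * (y j c - y i c) ^+ 2.

Definition consensual {R : realFieldType} {N : nat} {C : finType} (sh : pred C)
    (z : 'I_N -> C -> R) : Prop :=
  forall c, sh c -> forall i j, z i c = z j c.

Definition mixing {R : realFieldType} {N : nat} (a : R) (A : 'M[R]_N) : Prop :=
  [/\ forall i j, 0 <= A i j, forall i, \sum_j A i j = 1,
      forall j, \sum_i A i j = 1, forall i, a <= A i i &
      forall i j, A i j != 0 -> a <= A i j].

Lemma sqdist_ge0 (R : realFieldType) (I C : finType) (y z : I -> C -> R) :
  0 <= sqdist y z.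
Proof. by rewrite sumr_ge0// => i _; rewrite sumr_ge0// => c _; rewrite sqr_ge0. Qed.

Lemma sqdist_ge (R : realFieldType) (I C : finType) (y z : I -> C -> R) i c :
  (y i c - z i c) ^+ 2 <= sqdist y z.
Proof.
rewrite /sqdist (bigD1 i)//= (bigD1 c)//= -addrA lerDl addr_ge0//.
  by rewrite sumr_ge0// => ? _; rewrite sqr_ge0.
by rewrite sumr_ge0// => ? _; rewrite sumr_ge0// => ? _; rewrite sqr_ge0.
Qed.

Lemma sqdist_le_card (R : realFieldType) (I C : finType) (y z : I -> C -> R) (b : R) :
  (forall i c, (y i c - z i c) ^+ 2 <= b) -> sqdist y z <= (#|I| * #|C|)%:R * b.
Proof.
move=> yz; rewrite mulr_natl mulnC mulrnA -!sumr_const.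
by apply: ler_sum => i _; exact: ler_sum.
Qed.

Lemma spread_ge0 (R : realFieldType) (N : nat) (C : finType) (sh : pred C)
    (A : 'M[R]_N) (y : 'I_N -> C -> R) :
  (forall i j, 0 <= A i j) -> 0 <= spread sh A y.
Proof.
move=> A0; do 3 (apply: sumr_ge0 => ? _).
by rewrite mulr_ge0// sqr_ge0.
Qed.

Lemma spread_ge (R : realFieldType) (N : nat) (C : finType) (sh : pred C)
    (A : 'M[R]_N) (y : 'I_N -> C -> R) (i : 'I_N) (c : C) :
  (forall i j, 0 <= A i j) -> sh c ->
  \sum_j A i j * (y j c - y i c) ^+ 2 <= spread sh A y.
Proof.
move=> A0 shc; have T0 c' i' : 0 <= \sum_j A i' j * (y j c' - y i' c') ^+ 2.
  by rewrite sumr_ge0// => j _; rewrite mulr_ge0// sqr_ge0.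
rewrite /spread [leRHS](bigD1 c)//= [X in _ <= X + _](bigD1 i)//= -addrA lerDl addr_ge0//.
  by rewrite sumr_ge0.
by rewrite sumr_ge0// => ? _; rewrite sumr_ge0.
Qed.

Lemma average_contraction (R : realFieldType) (N : nat) (C : finType) (sh : pred C)
    (a : R) (A : 'M[R]_N) (y z : 'I_N -> C -> R) :
  0 < a -> mixing a A -> consensual sh z ->
  sqdist (average sh A y) z + a / (1 + a) * spread sh A y <= sqdist y z.
Proof.
move=> a0 [A0 Ar Ac aA _] zc.
rewrite /sqdist exchange_big [leRHS]exchange_big /= /spread mulr_sumr.
rewrite [in X in _ + X]big_mkcond -big_split; apply: ler_sum => c _ /=.
rewrite /average; case: ifPn => shc; last by rewrite addr0.
have [zv zE] : exists zv, forall i, z i c = zv.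
  case: (pickP (predT : pred 'I_N)) => [i1 _|N0]; last by exists 0 => i; have := N0 i.
  by exists (z i1 c) => i; exact: zc.
under eq_bigr do rewrite zE.
under [leRHS]eq_bigr do rewrite zE.
exact: (doubly_stochastic_contraction (y ^~ c) zv A0 Ar Ac a0 aA).
Qed.

Lemma average_reference (R : realFieldType) (N : nat) (C : finType) (sh : pred C)
    (a : R) (A : 'M[R]_N) (y : 'I_N -> C -> R) (i0 : 'I_N) :
  mixing a A ->
  sqdist (average sh A y) (reference sh i0 y) <= sqdist y (reference sh i0 y).
Proof.
move=> [A0 Ar Ac _ _]; rewrite /sqdist exchange_big [leRHS]exchange_big /=.
apply: ler_sum => c _; rewrite /average /reference; case: (boolP (sh c)) => // shc.
have -> : \sum_j (y j c - y i0 c) ^+ 2 = \sum_i \sum_j A i j * (y j c - y i0 c) ^+ 2.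
  by rewrite exchange_big; apply: eq_bigr => j _ /=; rewrite -mulr_suml Ac mul1r.
by apply: ler_sum => i _; exact: weighted_jensen.
Qed.

Lemma young (R : realFieldType) (al eps h w : R) : 0 < eps ->
  2 * al * (h * w) <= al ^+ 2 * h ^+ 2 / eps + eps * w ^+ 2.
Proof.
move=> e0; rewrite -subr_ge0.
have -> : al ^+ 2 * h ^+ 2 / eps + eps * w ^+ 2 - 2 * al * (h * w) =
  (al * h - eps * w) ^+ 2 / eps by field; rewrite gt_eqF.
by rewrite divr_ge0 ?sqr_ge0// ltW.
Qed.

(** One iteration [y -> y'], summed over the agents.  The projection inequalities
    give the distance after the step and the projection error; the inner product
    of the step with [v - z] is [- gap] up to the error of replacing the mean by
    the reference, which Young's inequality splits into [al ^+ 2] and the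
    disagreement. *)
Lemma projected_step_descent (R : realFieldType) (N : nat) (C : finType)
    (sh : pred C) (a : R) (A : 'M[R]_N) (y y' z D H : 'I_N -> C -> R)
    (i0 : 'I_N) (al gap C0 eps : R) :
  0 < a -> mixing a A -> consensual sh z -> 0 <= al -> 0 < eps ->
  sqdist D (fun _ _ => 0) <= C0 -> sqdist H (fun _ _ => 0) <= C0 ->
  (forall i, \sum_c (y' i c - z i c) ^+ 2
      + \sum_c (y' i c - (average sh A y i c + al * D i c)) ^+ 2
    <= \sum_c (average sh A y i c + al * D i c - z i c) ^+ 2) ->
  \sum_i \sum_c D i c * (average sh A y i c - z i c) <=
    - gap + \sum_i \sum_c H i c * (average sh A y i c - reference sh i0 y i c) ->
  sqdist y' z + (sqdist y' (fun i c => average sh A y i c + al * D i c)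
    + a / (1 + a) * spread sh A y) + 2 * al * gap
  <= sqdist y z + eps * sqdist y (reference sh i0 y) + (C0 / eps + C0) * al ^+ 2.
Proof.
move=> a0 mA zc al0 e0 DC HC proj sub.
have := average_contraction y a0 mA zc.
have := average_reference sh y i0 mA.
set v := average sh A y in proj sub *; set r := reference sh i0 y in sub *.
move=> vr vz.
have P : sqdist y' z + sqdist y' (fun i c => v i c + al * D i c) <=
    sqdist (fun i c => v i c + al * D i c) z.
  by rewrite -big_split; apply: ler_sum => i _; exact: proj.
have E : sqdist (fun i c => v i c + al * D i c) z = sqdist v z
   + 2 * al * (\sum_i \sum_c D i c * (v i c - z i c))
   + al ^+ 2 * sqdist D (fun _ _ => 0).
  rewrite /sqdist !mulr_sumr -!big_split; apply: eq_bigr => i _ /=.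
  rewrite !mulr_sumr -!big_split; apply: eq_bigr => c _ /=; ring.
have Y : 2 * al * (\sum_i \sum_c H i c * (v i c - r i c)) <=
    al ^+ 2 * sqdist H (fun _ _ => 0) / eps + eps * sqdist v r.
  rewrite /sqdist !mulr_sumr mulr_suml -big_split; apply: ler_sum => i _ /=.
  rewrite !mulr_sumr mulr_suml -big_split; apply: ler_sum => c _ /=.
  by rewrite subr0 young.
have Y2 : al ^+ 2 * sqdist H (fun _ _ => 0) / eps <= C0 / eps * al ^+ 2.
  by rewrite mulrAC [leRHS]mulrC -mulrA ler_wpM2l ?sqr_ge0// mulrC ler_pM2r ?invr_gt0.
have Y3 : al ^+ 2 * sqdist D (fun _ _ => 0) <= C0 * al ^+ 2.
  by rewrite [leRHS]mulrC ler_wpM2l ?sqr_ge0.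
have Y4 : eps * sqdist v r <= eps * sqdist y r by rewrite ler_pM2l.
have Y5 : 2 * al * (\sum_i \sum_c D i c * (v i c - z i c)) <=
  2 * al * (- gap + \sum_i \sum_c H i c * (v i c - r i c)).
  by rewrite ler_wpM2l// mulr_ge0.
lra.
Qed.

(** Two agents joined by an edge at some time of the window are close at that time,
    by the Dirichlet form, and no agent has moved far since the time [k]: an
    agent moves by its distance to the mean, by the step and by the projection
    error.  Chaining at most [N] such edges joins every agent to [i0].  All these
    distances are at most [rho], the square root of the sum over the window, up
    to a factor. *)
Lemma disagreement_window (R : rcfType) (N : nat) (C : finType)
    (sh : pred C) (a : R) (A : nat -> 'M[R]_N) (y D : nat -> 'I_N -> C -> R)
    (al : nat -> R) (C0 : R) (B k : nat) (i0 : 'I_N) :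
  0 < a -> (forall k, mixing a (A k)) ->
  (forall k, sqdist (D k) (fun _ _ => 0) <= C0) ->
  (forall i j, connect
    [rel j i | [exists s : 'I_B, (j != i) && (A (k + s)%N i j != 0)]] i j) ->
  sqdist (y k) (reference sh i0 (y k)) <=
   (N * #|C|)%:R * (((N * B.*2.+1) ^ 2)%:R * (3 + a^-1)) * \sum_(s < B)
     ((spread sh (A (k + s)%N) (y (k + s)%N)
       + sqdist (y (k + s).+1) (fun i c => average sh (A (k + s)%N) (y (k + s)%N) i c
           + al (k + s)%N * D (k + s)%N i c))
       + C0 * al (k + s)%N ^+ 2).
Proof.
move=> a0 mA DC conn.
pose E t := sqdist (y t.+1) (fun i c => average sh (A t) (y t) i c + al t * D t i c).
pose w t := spread sh (A t) (y t) + E t + C0 * al t ^+ 2.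
pose W := \sum_(s < B) w (k + s)%N; rewrite -[X in _ <= _ * X]/W.
have A0 t i j : 0 <= A t i j by case: (mA t).
have C00 : 0 <= C0 by rewrite (le_trans (sqdist_ge0 _ _) (DC 0%N)).
have w0 t : 0 <= w t.
  apply: addr_ge0; last by rewrite mulr_ge0 ?sqr_ge0.
  by apply: addr_ge0; [exact: spread_ge0 | exact: sqdist_ge0].
have wW (s : 'I_B) : w (k + s)%N <= W.
  by rewrite /W (bigD1 s)//= lerDl sumr_ge0.
have W0 : 0 <= W by rewrite sumr_ge0.
(* The summand 3 serves the three parts of a move, a^-1 an edge. *)
pose K := 3 + a^-1; have K0 : 0 <= K by rewrite addr_ge0// invr_ge0 ltW.
pose rho := Num.sqrt (K * W).
have rho0 : 0 <= rho by rewrite sqrtr_ge0.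
have le_rho u : u ^+ 2 <= K * W -> `|u| <= rho.
  by move=> uW; rewrite -sqrtr_sqr ler_sqrt// mulr_ge0.
rewrite -mulrA -[X in (X * _)%:R]card_ord; apply: sqdist_le_card => i c.
have rhs0 : 0 <= ((N * B.*2.+1) ^ 2)%:R * K * W by rewrite !mulr_ge0.
rewrite /reference; case: (boolP (sh c)) => [shc|_]; last by rewrite subrr expr0n.
have move1 t i' : (y t.+1 i' c - y t i' c) ^+ 2 <= 3 * w t.
  have [_ Ar _ _ _] := mA t.
  have m1 := weighted_jensen (y t ^~ c) (y t i' c) (A0 t i') (Ar i').
  have m2 := spread_ge (y t) i' (A0 t) shc.
  have m3 := sqdist_ge (y t.+1)
    (fun i c => average sh (A t) (y t) i c + al t * D t i c) i' c.
  rewrite -/(E t) /average shc in m3.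
  have m4 := le_trans (sqdist_ge (D t) (fun _ _ => 0) i' c) (DC t).
  rewrite subr0 in m4.
  set m := \sum_j _ in m1 m3; rewrite /= in m1.
  have m5 : al t ^+ 2 * D t i' c ^+ 2 <= C0 * al t ^+ 2.
    by rewrite [leRHS]mulrC ler_wpM2l ?sqr_ge0.
  rewrite /w.
  have -> : y t.+1 i' c - y t i' c =
    (m - y t i' c) + (y t.+1 i' c - (m + al t * D t i' c)) + al t * D t i' c by ring.
  rewrite -exprMn in m5.
  move: m1 m2 m3 m5; set p := m - _; set q := y t.+1 i' c - _; set u := al t * _.
  move=> m1 m2 m3 m5.
  have : (p + q + u) ^+ 2 <= 3 * (p ^+ 2 + q ^+ 2 + u ^+ 2).
    have := sqr_ge0 (p - q); have := sqr_ge0 (p - u); have := sqr_ge0 (q - u).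
    rewrite !expr2; lra.
  lra.
have drift i' s : (s <= B)%N -> `|y (k + s)%N i' c - y k i' c| <= s%:R * rho.
  elim: s => [|s IH] sB; first by rewrite addn0 subrr normr0 mul0r.
  rewrite -natr1 mulrDl mul1r [leRHS]addrC addnS.
  apply: le_trans (ler_distD (y (k + s)%N i' c) _ _) _.
  apply: lerD; last exact: (IH (ltnW sB)).
  apply: le_rho; apply: le_trans (move1 _ _) _.
  by apply: ler_pM => //; [rewrite lerDl invr_ge0 ltW | exact: (wW (Ordinal sB))].
have edge_le t i' j' : A t i' j' != 0 -> (y t j' c - y t i' c) ^+ 2 <= a^-1 * w t.
  move=> Aij; have [_ _ _ _ /(_ _ _ Aij) aij] := mA t.
  rewrite ler_pdivlMl//; apply: le_trans (ler_wpM2r (sqr_ge0 _) aij) _.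
  apply: le_trans (_ : _ <= spread sh (A t) (y t)) _; last first.
    by rewrite /w -addrA lerDl addr_ge0 ?sqdist_ge0// mulr_ge0 ?sqr_ge0.
  apply: le_trans (spread_ge (y t) i' (A0 t) shc).
  by rewrite (bigD1 j')//= lerDl sumr_ge0// => l _; rewrite mulr_ge0 ?sqr_ge0.
(* An edge at time k + s costs rho, and returning to time k costs at most
   B * rho at each end. *)
have hop i' j' : [exists s : 'I_B, (i' != j') && (A (k + s)%N j' i' != 0)] ->
    `|y k i' c - y k j' c| <= B.*2.+1%:R * rho.
  move=> /existsP[s /andP[_ /edge_le e]].
  have d1 := drift i' s (ltnW (ltn_ord s)); have d2 := drift j' s (ltnW (ltn_ord s)).
  have e1 : `|y (k + s)%N i' c - y (k + s)%N j' c| <= rho.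
    apply: le_rho; apply: le_trans e _.
    by apply: ler_pM => //; [rewrite invr_ge0 ltW | rewrite lerDr].
  have sB : s%:R * rho <= B%:R * rho by rewrite ler_wpM2r// ler_nat ltnW.
  apply: le_trans (ler_distD (y (k + s)%N i' c) _ _) _.
  have := ler_distD (y (k + s)%N j' c) (y (k + s)%N i' c) (y k j' c).
  rewrite distrC in d1 => d3.
  rewrite -natr1 -muln2 natrM; lra.
have fin := connect_dist (mulr_ge0 (ler0n _ _) rho0) hop (conn i i0).
rewrite card_ord mulrA -natrM in fin.
have := lerXn2r 2 _ _ fin; rewrite !nnegrE normr_ge0 mulr_ge0// => /(_ isT isT).
rewrite real_normK ?num_real// => /le_trans; apply.
by rewrite exprMn sqr_sqrtr ?mulr_ge0// natrX mulrA.
Qed.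

(** * Multipliers in coordinates *)

(** The entries of [mu_i], of [lambda] and of [w], in this order. *)
Definition coordT (N n m : nat) : finType := ('I_m + 'I_N * 'I_n + 'I_N * 'I_n)%type.

Definition coord {R : realType} {N n m : nat} (xi : ldual R N n m)
    (c : coordT N n m) : R :=
  match c with
  | inl (inl j) => xi.1.1 0 j
  | inl (inr p) => xi.1.2 p.1 p.2
  | inr p => xi.2 p.1 p.2
  end.

Definition shared {N n m : nat} : pred (coordT N n m) :=
  fun c => if c is inl (inl _) then false else true.

Lemma big_coord (R : realType) (N n m : nat) (F : coordT N n m -> R) :
  \sum_c F c = \sum_j F (inl (inl j)) + \sum_i \sum_j F (inl (inr (i, j)))
    + \sum_i \sum_j F (inr (i, j)).
Proof.
rewrite big_sumType /= big_sumType /=; congr (_ + _ + _).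
  by rewrite pair_bigA; apply: eq_bigr => -[].
by rewrite pair_bigA; apply: eq_bigr => -[].
Qed.

Lemma coordD (R : realType) (N n m : nat) (u v : ldual R N n m) c :
  coord (u + v) c = coord u c + coord v c.
Proof. by case: c => [[j|p]|p]; rewrite /= mxE. Qed.

Lemma coordB (R : realType) (N n m : nat) (u v : ldual R N n m) c :
  coord (u - v) c = coord u c - coord v c.
Proof. by case: c => [[j|p]|p]; rewrite /= !mxE. Qed.

Lemma coordZ (R : realType) (N n m : nat) (t : R) (u : ldual R N n m) c :
  coord (t *: u) c = t * coord u c.
Proof. by case: c => [[j|p]|p]; rewrite /= mxE. Qed.

Lemma lnormE (R : realType) (N n m : nat) (u : ldual R N n m) :
  lnorm u = Num.sqrt (\sum_c coord u c ^+ 2).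
Proof. by rewrite /lnorm /sqnorm big_coord /= big_ord1. Qed.

Lemma Xi'P (R : realType) (N n m : nat) (u : ldual R N n m) :
  Xi' u <-> forall c, 0 <= coord u c.
Proof.
split=> [[/mxOverP u1 /mxOverP u2 /mxOverP u3] [[j|p]|p] /=|u0].
- exact: u1.
- exact: u2.
- exact: u3.
split; apply/mxOverP => i j.
- by rewrite ord1; exact: (u0 (inl (inl j))).
- exact: (u0 (inl (inr (i, j)))).
- exact: (u0 (inr (i, j))).
Qed.

Lemma coord_mix (R : realType) (N n m : nat) (A : 'M[R]_N)
    (xi : 'I_N -> ldual R N n m) i c :
  coord (mix A xi i) c = average shared A (fun j => coord (xi j)) i c.
Proof.
case: c => [[j|p]|p]; rewrite /average //= summxE; apply: eq_bigr => l _; by rewrite mxE.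
Qed.

Lemma sum_at (R : realType) (N : nat) (i : 'I_N) (F : 'I_N -> R) :
  \sum_(j < N) (if j == i then F j else 0) = F i.
Proof. by rewrite -big_mkcond big_pred1_eq. Qed.

(** The direction of the algorithm is the gradient of the local Lagrangian with
    respect to the multipliers, for fixed [x]. *)
Lemma local_lagrangianE (R : realType) (N n m : nat)
    (f : 'I_N -> 'rV[R]_n -> R) (g : 'rV[R]_n -> 'rV[R]_m) (s : {perm 'I_N})
    (delta : R) (i : 'I_N) (x : 'rV[R]_n) (xi : ldual R N n m) :
  local_lagrangian f g s delta i x xi =
  f i x + \sum_c coord (direction g s delta i x) c * coord xi c.
Proof.
case: xi => [[mu la] w]; rewrite /local_lagrangian big_coord /= -!addrA; congr (_ + _).
congr (_ + _); first by apply: eq_bigr => j _; rewrite mulrC.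
(* If i and inn s i coincide, the two contributions to the block add up. *)
have E (M : 'M[R]_(N, n)) (a b : 'rV[R]_n) :
  \sum_k \sum_j (\matrix_(l < N) ((if l == i then a else 0) +
      (if l == inn s i then b else 0))) k j * M k j =
  dotp a (row i M) + dotp b (row (inn s i) M).
  rewrite -(sum_at i (fun k => dotp a (row k M)))
    -(sum_at (inn s i) (fun k => dotp b (row k M))) -big_split.
  apply: eq_bigr => k _ /=.
  have -> : (if k == i then dotp a (row k M) else 0) =
     dotp (if k == i then a else 0) (row k M).
    by case: ifP => // _; rewrite /dotp big1// => j _; rewrite mxE mul0r.
  have -> : (if k == inn s i then dotp b (row k M) else 0) =
     dotp (if k == inn s i then b else 0) (row k M).
    by case: ifP => // _; rewrite /dotp big1// => j _; rewrite mxE mul0r.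
  by rewrite /dotp -big_split; apply: eq_bigr => j _; rewrite !mxE mulrDl.
rewrite !E /dotp -!sumrN -!big_split; apply: eq_bigr => j _ /=; rewrite !mxE; ring.
Qed.

Lemma dotpDr (R : realType) (p : nat) (u v w : 'rV[R]_p) :
  dotp u (v + w) = dotp u v + dotp u w.
Proof. by rewrite -big_split; apply: eq_bigr => j _; rewrite mxE mulrDr. Qed.

Lemma dotpNr (R : realType) (p : nat) (u v : 'rV[R]_p) : dotp u (- v) = - dotp u v.
Proof. by rewrite -sumrN; apply: eq_bigr => j _; rewrite mxE mulrN. Qed.

Lemma dotpDl (R : realType) (p : nat) (u v w : 'rV[R]_p) :
  dotp (v + w) u = dotp v u + dotp w u.
Proof. by rewrite -big_split; apply: eq_bigr => j _; rewrite mxE mulrDl. Qed.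

Lemma dotpNl (R : realType) (p : nat) (u v : 'rV[R]_p) : dotp (- v) u = - dotp v u.
Proof. by rewrite -sumrN; apply: eq_bigr => j _; rewrite mxE mulNr. Qed.

(** Summing over the cycle, the neighbour [x_(i_D)] paired with [lambda_i] is
    re-indexed as [x_i] paired with [lambda_(i_U)]. *)
Lemma lagrangian_local (R : realType) (N n m : nat)
    (f : 'I_N -> 'rV[R]_n -> R) (g : 'rV[R]_n -> 'rV[R]_m) (s : {perm 'I_N})
    (delta : R) (x : 'M[R]_(N, n)) (xi : gdual R N n m) :
  lagrangian f g s delta x xi =
  \sum_i local_lagrangian f g s delta i (row i x) (local xi i).
Proof.
have shift (M : 'M[R]_(N, n)) :
    \sum_i dotp (row i M) (row (outn s i) x) = \sum_i dotp (row (inn s i) M) (row i x).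
  rewrite [RHS](reindex_inj (@perm_inj _ s)); apply: eq_bigr => i _.
  by rewrite /inn /outn permK.
case: xi => [[mu la] w]; rewrite /lagrangian /local_lagrangian /=.
under eq_bigr do rewrite !dotpDr !dotpNr.
under [RHS]eq_bigr do rewrite !dotpDl !dotpNl.
rewrite !big_split /= !sumrN !shift; ring.
Qed.

(** The angle at the projection [p] between [v - p] and [q - p] is obtuse; it is
    obtained by comparing [p] with the points [p + t (q - p)] of the convex ball
    for small [t]. *)
Lemma proj_obtuse (R : realType) (N n m : nat) (r : R) (v p q : ldual R N n m) :
  is_proj (dual_ball r) v p -> dual_ball r q ->
  \sum_c (coord p c - coord q c) ^+ 2 + \sum_c (coord p c - coord v c) ^+ 2
  <= \sum_c (coord v c - coord q c) ^+ 2.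
Proof.
move=> [[/Xi'P p0 pr] pmin] [/Xi'P q0 qr].
have S0 (F : coordT N n m -> R) : 0 <= \sum_c F c ^+ 2.
  by rewrite sumr_ge0// => c _; rewrite sqr_ge0.
have r0 : 0 <= r by rewrite (le_trans _ pr)// lnormE sqrtr_ge0.
have le_sq u : lnorm u <= r -> \sum_c coord u c ^+ 2 <= r ^+ 2.
  by rewrite lnormE -{1}(ger0_norm r0) -sqrtr_sqr ler_sqrt ?sqr_ge0.
pose X := \sum_c (coord v c - coord p c) * (coord q c - coord p c).
pose Y := \sum_c (coord q c - coord p c) ^+ 2.
have step t : 0 < t -> t <= 1 -> 2 * X <= t * Y.
  move=> t0 t1; have : dual_ball r (p + t *: (q - p)).
    split.
      apply/Xi'P => c; rewrite coordD coordZ coordB.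
      have -> : coord p c + t * (coord q c - coord p c) =
        (1 - t) * coord p c + t * coord q c by ring.
      by apply: addr_ge0; apply: mulr_ge0; rewrite ?subr_ge0 ?p0 ?q0 ?(ltW t0).
    rewrite lnormE -(ger0_norm r0) -sqrtr_sqr ler_sqrt ?sqr_ge0//.
    apply: le_trans (_ : _ <= (1 - t) * (\sum_c coord p c ^+ 2)
       + t * (\sum_c coord q c ^+ 2)) _.
      rewrite !mulr_sumr -big_split; apply: ler_sum => c _ /=.
      rewrite coordD coordZ coordB.
      rewrite -subr_ge0; set a := coord p c; set b := coord q c.
      have -> : (1 - t) * a ^+ 2 + t * b ^+ 2 - (a + t * (b - a)) ^+ 2 =
         (1 - t) * t * (b - a) ^+ 2 by ring.
      by apply: mulr_ge0 (sqr_ge0 _); apply: mulr_ge0; rewrite ?subr_ge0 ?(ltW t0).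
    have -> : r ^+ 2 = (1 - t) * r ^+ 2 + t * r ^+ 2 by ring.
    by apply: lerD; apply: ler_wpM2l; rewrite ?le_sq ?subr_ge0 ?(ltW t0).
  move=> /pmin; rewrite !lnormE ler_sqrt//.
  have -> : \sum_c coord (v - (p + t *: (q - p))) c ^+ 2 =
     \sum_c coord (v - p) c ^+ 2 - t * (2 * X) + t ^+ 2 * Y.
    rewrite /X /Y !mulr_sumr -sumrB -big_split; apply: eq_bigr => c _ /=.
    rewrite !coordB coordD coordZ coordB; ring.
  move=> le0; rewrite -(ler_pM2l t0); lra.
have Y0 : 0 <= Y by exact: S0.
have X0 : X <= 0.
  rewrite leNgt; apply/negP => X0.
  have XY : 0 < X + Y by rewrite ltr_wpDr.
  (* This t makes t * Y smaller than 2 * X. *)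
  have := step (X / (X + Y)); rewrite divr_gt0// ler_pdivrMr// mul1r lerDl => /(_ isT Y0).
  rewrite mulrAC ler_pdivlMr//; nra.
have -> : \sum_c (coord v c - coord q c) ^+ 2 =
    \sum_c (coord p c - coord q c) ^+ 2 + \sum_c (coord p c - coord v c) ^+ 2 - 2 * X.
  rewrite /X !mulr_sumr -sumrN -!big_split; apply: eq_bigr => c _ /=; ring.
lra.
Qed.

(** The multiplier with the private parts of all agents and the shared part of
    agent [i0]. *)
Definition gdual_of {R : realType} {N n m : nat} (i0 : 'I_N)
    (z : 'I_N -> coordT N n m -> R) : gdual R N n m :=
  (\matrix_(i, j) z i (inl (inl j)), \matrix_(i, j) z i0 (inl (inr (i, j))),
   \matrix_(i, j) z i0 (inr (i, j))).

Lemma coord_gdual_of (R : realType) (N n m : nat) (i0 : 'I_N)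
    (z : 'I_N -> coordT N n m -> R) i :
  coord (local (gdual_of i0 z) i) = reference shared i0 z i.
Proof.
by apply/funext => -[[j|[k j]]|[k j]]; rewrite /reference /= !mxE.
Qed.

Lemma XiP (R : realType) (N n m : nat) (xi : gdual R N n m) : (0 < N)%N ->
  Xi xi <-> forall i c, 0 <= coord (local xi i) c.
Proof.
move=> N0; split=> [[/mxOverP u1 /mxOverP u2 /mxOverP u3] i [[j|p]|p] /=|u0].
- by rewrite mxE; exact: u1.
- exact: u2.
- exact: u3.
split; apply/mxOverP => i j.
- by have := u0 i (inl (inl j)); rewrite /= mxE.
- exact: (u0 i (inl (inr (i, j)))).
- exact: (u0 i (inr (i, j))).
Qed.

Lemma consensual_local (R : realType) (N n m : nat) (xi : gdual R N n m) :
  consensual shared (fun i => coord (local xi i)).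
Proof. by case=> [[j|p]|p]. Qed.

(** * The dual function and its supergradients *)

Lemma continuous_bounded_on_compact (R : realType) (T : topologicalType)
    (I : finType) (X : set T) (h : I -> T -> R) :
  compact X -> (forall i, continuous (h i)) ->
  exists2 b : R, 0 < b & forall i x, X x -> `|h i x| <= b.
Proof.
move=> Xc hc; have [->|/set0P X0] := eqVneq X set0; first by exists 1.
have /choice[b bP] : forall i, exists b, forall x, X x -> `|h i x| <= b.
  move=> i; have nc : continuous (fun x => `|h i x|).
    by move=> x; apply: cvg_norm; exact: hc.
  have [c _ cP] := compact_EVT_max X0 Xc (continuous_subspaceT nc).
  by exists `|h i c| => x /mem_set; exact: cP.
exists (1 + \sum_i `|b i|); first by rewrite ltr_pwDl// sumr_ge0.
move=> i x Xx; apply: le_trans (bP i x Xx) _; apply: le_trans (ler_norm _) _.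
by rewrite (bigD1 i)//= addrCA lerDl addr_ge0// sumr_ge0.
Qed.

Lemma continuous_min_on_compact (R : realType) (T : topologicalType)
    (X : set T) (h : T -> R) :
  X !=set0 -> compact X -> continuous h -> argmin X h !=set0.
Proof.
move=> X0 Xc hc.
have [c /set_mem Xc' cP] := compact_EVT_min X0 Xc (continuous_subspaceT hc).
by exists c; split=> // y /mem_set; exact: cP.
Qed.

Lemma coord_direction_continuous (R : realType) (N n m : nat)
    (g : 'rV[R]_n -> 'rV[R]_m) (s : {perm 'I_N}) (delta : R) (i : 'I_N)
    (c : coordT N n m) :
  continuous g -> continuous (fun x => coord (direction g s delta i x) c).
Proof.
move=> gc; case: c => [[j|[k j]]|[k j]].
- move=> x; exact: (@continuous_comp _ _ _ g (fun M : 'rV_m => M 0 j) x (gc x)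
    (@coord_continuous R 1 m 0 j (g x))).
- have -> : (fun x => coord (direction g s delta i x) (inl (inr (k, j)))) =
      (fun x => (if k == i then - delta - x 0 j else 0) +
                (if k == inn s i then x 0 j else 0)).
    by apply/funext => x; rewrite /= !mxE; case: ifP => _; case: ifP => _; rewrite !mxE.
  move=> x; have xc := @coord_continuous R 1 n 0 j x.
  apply: (@cvgD _ _ _ _ (nbhs_filter (x : 'rV[R]_n))).
    by case: (k == i); [exact: (cvgB (cvg_cst (- delta)) xc) | exact: cvg_cst].
  by case: (k == inn s i) => //; exact: cvg_cst.
- have -> : (fun x => coord (direction g s delta i x) (inr (k, j))) =
      (fun x => (if k == i then - delta + x 0 j else 0) +
                (if k == inn s i then - x 0 j else 0)).
    by apply/funext => x; rewrite /= !mxE; case: ifP => _; case: ifP => _; rewrite !mxE.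
  move=> x; have xc := @coord_continuous R 1 n 0 j x.
  apply: (@cvgD _ _ _ _ (nbhs_filter (x : 'rV[R]_n))).
    by case: (k == i); [exact: (cvgD (cvg_cst (- delta)) xc) | exact: cvg_cst].
  by case: (k == inn s i); [exact: (cvgN xc) | exact: cvg_cst].
Qed.

Lemma local_lagrangian_continuous (R : realType) (N n m : nat)
    (f : 'I_N -> 'rV[R]_n -> R) (g : 'rV[R]_n -> 'rV[R]_m) (s : {perm 'I_N})
    (delta : R) (i : 'I_N) (xi : ldual R N n m) :
  continuous (f i) -> continuous g ->
  continuous (fun x => local_lagrangian f g s delta i x xi).
Proof.
move=> fc gc.
have -> : (fun x => local_lagrangian f g s delta i x xi) = (fun x => f i x +
    \sum_c coord (direction g s delta i x) c * coord xi c).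
  by apply/funext => x; rewrite local_lagrangianE.
move=> x; apply: (@cvgD _ _ _ _ (nbhs_filter (x : 'rV[R]_n))); first exact: fc.
apply: (@cvg_big R _ +%R 0 xpredT (@add_continuous R) _ _ _ _ _
  (nbhs_filter (x : 'rV[R]_n))) => c _.
apply: (@cvgM _ _ _ (nbhs_filter (x : 'rV[R]_n))); last exact: cvg_cst.
exact: coord_direction_continuous.
Qed.

Lemma marginal_exists (R : realType) (N n m : nat)
    (f : 'I_N -> 'rV[R]_n -> R) (g : 'rV[R]_n -> 'rV[R]_m) (X : set 'rV[R]_n)
    (s : {perm 'I_N}) (delta : R) :
  (forall i, continuous (f i)) -> continuous g -> compact X -> X !=set0 ->
  forall i (xi : ldual R N n m), marginal f g X s delta i xi !=set0.
Proof.
move=> fc gc Xc X0 i xi.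
by apply: continuous_min_on_compact => //; exact: local_lagrangian_continuous.
Qed.

Lemma local_lagrangian_affine (R : realType) (N n m : nat)
    (f : 'I_N -> 'rV[R]_n -> R) (g : 'rV[R]_n -> 'rV[R]_m)
    (s : {perm 'I_N}) (delta : R) i x (xi xi' : ldual R N n m) :
  local_lagrangian f g s delta i x xi' = local_lagrangian f g s delta i x xi +
  \sum_c coord (direction g s delta i x) c * (coord xi' c - coord xi c).
Proof.
rewrite !local_lagrangianE -addrA -big_split; congr (_ + _).
by apply: eq_bigr => c _ /=; ring.
Qed.

Lemma lagrangian_affine (R : realType) (N n m : nat)
    (f : 'I_N -> 'rV[R]_n -> R) (g : 'rV[R]_n -> 'rV[R]_m)
    (s : {perm 'I_N}) (delta : R) (x : 'M[R]_(N, n)) (xi xi' : gdual R N n m) :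
  lagrangian f g s delta x xi' = lagrangian f g s delta x xi +
  \sum_i \sum_c coord (direction g s delta i (row i x)) c *
    (coord (local xi' i) c - coord (local xi i) c).
Proof.
rewrite !lagrangian_local -big_split; apply: eq_bigr => i _.
exact: local_lagrangian_affine.
Qed.

(** The Lagrangian separates over the agents, so the infimum over [X^N] is attained
    at any family of local minimizers. *)
Lemma dual_funE (R : realType) (N n m : nat)
    (f : 'I_N -> 'rV[R]_n -> R) (g : 'rV[R]_n -> 'rV[R]_m) (X : set 'rV[R]_n)
    (s : {perm 'I_N}) (delta : R) (xi : gdual R N n m) (x : 'M[R]_(N, n)) :
  (forall i, marginal f g X s delta i (local xi i) (row i x)) ->
  dual_fun f g X s delta xi = lagrangian f g s delta x xi.
Proof.
move=> xm; set E := [set lagrangian f g s delta x xi |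
       x in [set x : 'M[R]_(N, n) | forall i, X (row i x)]].
have Ex : E (lagrangian f g s delta x xi).
  by exists x => // i; case: (xm i).
have lb : lbound E (lagrangian f g s delta x xi).
  move=> _ [y Xy <-]; rewrite !lagrangian_local; apply: ler_sum => i _.
  by case: (xm i) => _; apply; exact: Xy.
apply/eqP; rewrite eq_le; apply/andP; split.
  by apply: ge_inf => //; exists (lagrangian f g s delta x xi).
by apply: lb_le_inf => //; exists (lagrangian f g s delta x xi).
Qed.

(** With [local_lagrangian_affine] and [dual_funE] this says that the directions at
    local minimizers are supergradients of the dual function. *)
Lemma dual_fun_le (R : realType) (N n m : nat)
    (f : 'I_N -> 'rV[R]_n -> R) (g : 'rV[R]_n -> 'rV[R]_m) (X : set 'rV[R]_n)
    (s : {perm 'I_N}) (delta : R) (xi : gdual R N n m) (x : 'I_N -> 'rV[R]_n) :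
  (forall i, continuous (f i)) -> continuous g -> compact X ->
  (forall i, X (x i)) ->
  dual_fun f g X s delta xi <= \sum_i local_lagrangian f g s delta i (x i) (local xi i).
Proof.
move=> fc gc Xc Xx.
case: (pickP (predT : pred 'I_N)) => [i1 _|N0]; last first.
  rewrite (@dual_funE _ _ _ _ _ _ _ _ _ _ (\matrix_i x i)) => [|i]; last by have := N0 i.
  by rewrite lagrangian_local !big_pred0.
have X0 : X !=set0 by exists (x i1).
have /choice[y ym] : forall i, exists y, marginal f g X s delta i (local xi i) y.
  by move=> i; exact: marginal_exists.
rewrite (@dual_funE _ _ _ _ _ _ _ _ _ _ (\matrix_i y i)); last first.
  by move=> i; rewrite rowK; exact: ym.
rewrite lagrangian_local; apply: ler_sum => i _; rewrite rowK.
by case: (ym i) => _; apply; exact: Xx.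
Qed.

(** * Slater bound on the dual optima *)

Lemma beta_gt0 (R : realType) (n m : nat) (g : 'rV[R]_n -> 'rV[R]_m) (delta : R)
    (z : 'rV[R]_n) : 0 < delta -> lt0v (g z) -> 0 < beta g delta z.
Proof.
move=> d0 gz; apply: (big_ind (fun b => 0 < b)) => // [u v u0 v0|l _].
  by rewrite lt_min u0.
by rewrite oppr_gt0; exact: gz.
Qed.

Lemma beta_le_delta (R : realType) (n m : nat) (g : 'rV[R]_n -> 'rV[R]_m) (delta : R)
    (z : 'rV[R]_n) : beta g delta z <= delta.
Proof.
by rewrite /beta; elim/big_rec: _ => // l b _ bd; rewrite ge_min bd orbT.
Qed.

Lemma beta_le_slack (R : realType) (n m : nat) (g : 'rV[R]_n -> 'rV[R]_m) (delta : R)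
    (z : 'rV[R]_n) l : beta g delta z <= - g z 0 l.
Proof. by rewrite /beta (bigD1 l)//= ge_min lexx. Qed.

Lemma local_sum_le (R : realType) (N n m : nat) (xi : gdual R N n m) (i : 'I_N) :
  Xi xi -> \sum_c coord (local xi i) c <=
    \sum_i \sum_j xi.1.1 i j + \sum_i \sum_j xi.1.2 i j + \sum_i \sum_j xi.2 i j.
Proof.
move=> [/mxOverP u1 _ _]; rewrite big_coord /= !lerD2r (bigD1 i)//=.
under eq_bigr do rewrite mxE.
by rewrite lerDl sumr_ge0// => k _; rewrite sumr_ge0// => j _; exact: u1.
Qed.

(** At the Slater vector each constraint of the approximate problem has slack at
    least [beta]; the consensus constraints have slack exactly [delta].  So
    [Q xi] is at most the cost of the Slater vector minus [beta] times the sum of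
    all multipliers, while [Q 0] is the sum of the infima of the [f i]. *)
Lemma slater_dual_bound (R : realType) (N n m : nat)
    (f : 'I_N -> 'rV[R]_n -> R) (g : 'rV[R]_n -> 'rV[R]_m) (X : set 'rV[R]_n)
    (s : {perm 'I_N}) (delta : R) (zbar : 'rV[R]_n) (xi : gdual R N n m) :
  (forall i, continuous (f i)) -> continuous g -> compact X ->
  0 < delta -> slater_vector g X zbar -> Xi xi ->
  dual_fun f g X s delta 0 <= dual_fun f g X s delta xi ->
  forall i, \sum_c coord (local xi i) c <= gamma f g X delta zbar.
Proof.
move=> fc gc Xc d0 [Xz gz] xi0 le0 i.
have X0 : X !=set0 by exists zbar.
apply: le_trans (local_sum_le i xi0) _.
set tot := (X in X <= _).
have b0 := beta_gt0 d0 gz; set b := beta g delta zbar in b0.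
have up : dual_fun f g X s delta xi <= \sum_i f i zbar - b * tot.
  apply: le_trans (dual_fun_le s delta xi fc gc Xc (fun=> Xz)) _.
  have -> : \sum_i local_lagrangian f g s delta i zbar (local xi i) =
      lagrangian f g s delta (\matrix_(i < N) zbar) xi.
    by rewrite lagrangian_local; apply: eq_bigr => k _; rewrite rowK.
  rewrite /lagrangian !big_split /= -!addrA lerD//.
    by apply: ler_sum => k _; rewrite rowK.
  rewrite /tot -!big_split mulr_sumr -sumrN; apply: ler_sum => k _ /=.
  rewrite !rowK addNr subrr sub0r.
  case: xi0 => [/mxOverP u1 /mxOverP u2 /mxOverP u3].
  rewrite !mulrDr !opprD -!addrA lerD//.
    rewrite mulr_sumr -sumrN; apply: ler_sum => j _; rewrite mxE -mulNr mulrC.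
    by apply: ler_wpM2r; [exact: u1 | rewrite lerNr; exact: beta_le_slack].
  have dlt (M : 'M[R]_(N, n)) : M \is a mxOver Num.nneg ->
      dotp (row k M) (- Delta delta) <= - (b * \sum_j M k j).
    move=> /mxOverP M0; rewrite mulr_sumr -sumrN; apply: ler_sum => j _.
    rewrite !mxE -mulNr mulrC; apply: ler_wpM2r; first exact: M0.
    by rewrite lerN2 beta_le_delta.
  by rewrite lerD// dlt//; apply/mxOverP.
have lo : \sum_i inf (f i @` X) <= dual_fun f g X s delta 0.
  have /choice[y ym] : forall i,
      exists y, marginal f g X s delta i (local (0 : gdual R N n m) i) y.
    by move=> k; exact: marginal_exists.
  rewrite (@dual_funE _ _ _ _ _ _ _ _ _ _ (\matrix_k y k)); last first.
    by move=> k; rewrite rowK; exact: ym.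
  rewrite lagrangian_local; apply: ler_sum => k _; rewrite rowK local_lagrangianE.
  rewrite [X in _ + X]big1 ?addr0; last first.
    by move=> -[[j|p]|p] _; rewrite /= ?mxE mulr0.
  have [c [_ cP]] := continuous_min_on_compact X0 Xc (fc k).
  apply: ge_inf; first by exists (f k c) => _ [z Xz' <-]; exact: cP.
  by exists (y k) => //; case: (ym k).
have : tot <= \sum_i gammai f g X delta zbar i.
  rewrite /gammai -mulr_suml sumrB -/b ler_pdivlMr// mulrC; lra.
move=> /le_trans; apply; rewrite /gamma mulr_natl -[X in _ *+ X]card_ord -sumr_const.
by apply: ler_sum => k _; exact: le_bigmax.
Qed.

Lemma dual_ball_of_sum (R : realType) (N n m : nat) (u : ldual R N n m) (r : R) :
  (forall c, 0 <= coord u c) -> \sum_c coord u c <= r -> dual_ball r u.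
Proof.
move=> u0 ur; split; first exact/Xi'P.
have S0 : 0 <= \sum_c coord u c by rewrite sumr_ge0.
apply: le_trans ur; rewrite lnormE -[leRHS](ger0_norm S0) -sqrtr_sqr ler_wsqrtr//.
rewrite expr2 mulr_suml; apply: ler_sum => c _.
rewrite expr2 ler_wpM2l// (bigD1 c)//= lerDl sumr_ge0//.
Qed.

Lemma coord_le_lnorm (R : realType) (N n m : nat) (u : ldual R N n m) c :
  `|coord u c| <= lnorm u.
Proof.
rewrite lnormE -sqrtr_sqr ler_wsqrtr// (bigD1 c)//= lerDl.
by rewrite sumr_ge0// => ? _; rewrite sqr_ge0.
Qed.

(** The Bolzano-Weierstrass theorem in a finite-dimensional space, stated without
    extracting a subsequence. *)
Lemma bounded_cluster (R : realType) (I : finType) (u : nat -> I -> R) (r : R) :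
  (forall k i, `|u k i| <= r) ->
  exists2 p : I -> R, forall i, `|p i| <= r &
    forall (eps : R) K, 0 < eps ->
      exists2 k, (K <= k)%N & forall i, `|p i - u k i| < eps.
Proof.
move=> ur.
pose v k : 'rV[R]_#|I| := \row_j u k (enum_val j).
have Sc : compact [set w : 'rV[R]_#|I| | forall j, `[-r, r]%classic (w ord0 j)].
  by apply: (@rV_compact _ _ (fun=> `[-r, r]%classic)) => j; exact: segment_compact.
have [|w [wS wc]] := Sc (v @ \oo) _.
  exists 0%N => // k _ j /=; rewrite in_itv /= -ler_norml mxE; exact: ur.
exists (fun i => w 0 (enum_rank i)) => [i|eps K e0].
  by have := wS (enum_rank i); rewrite /= in_itv /= -ler_norml.
have tail : (v @ \oo) (v @` [set k | (K <= k)%N]).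
  by exists K => // k /= Kk; exists k.
have [z [[k /= Kk <-] [_ wz]]] := wc _ (ball w eps) tail (nbhsx_ballx _ _ e0).
by exists k => // i; have := wz 0 (enum_rank i); rewrite mxE enum_rankK.
Qed.

(** * Existence of dual optima and stability of minimizers *)

Lemma sum_dist_le (R : realDomainType) (I : finType) (u v : I -> R) (b eta : R) :
  (forall i, `|u i| <= b) -> (forall i, `|v i| <= eta) ->
  \sum_i u i * v i <= #|I|%:R * (b * eta).
Proof.
move=> ub ve; rewrite mulr_natl -sumr_const; apply: ler_sum => i _.
by apply: le_trans (ler_norm _) _; rewrite normrM ler_pM.
Qed.

Lemma dual_fun_usc (R : realType) (N n m : nat)
    (f : 'I_N -> 'rV[R]_n -> R) (g : 'rV[R]_n -> 'rV[R]_m) (X : set 'rV[R]_n)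
    (s : {perm 'I_N}) (delta : R) (p : gdual R N n m) (eps : R) :
  (forall i, continuous (f i)) -> continuous g -> compact X -> X !=set0 ->
  0 < eps -> exists2 eta : R, 0 < eta & forall xi,
    (forall i c, `|coord (local p i) c - coord (local xi i) c| < eta) ->
    dual_fun f g X s delta xi <= dual_fun f g X s delta p + eps.
Proof.
move=> fc gc Xc X0 e0.
have /choice[y ym] : forall i, exists y, marginal f g X s delta i (local p i) y.
  by move=> i; exact: marginal_exists.
have Xy i : X (y i) by case: (ym i).
pose T := 1 + \sum_i \sum_c `|coord (direction g s delta i (y i)) c|.
have T0 : 0 < T by rewrite ltr_pwDl// sumr_ge0// => i _; rewrite sumr_ge0.
exists (eps / T); first exact: divr_gt0.
move=> xi close; apply: le_trans (dual_fun_le s delta xi fc gc Xc Xy) _.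
rewrite (@dual_funE _ _ _ _ _ _ _ _ _ _ (\matrix_k y k)); last first.
  by move=> k; rewrite rowK; exact: ym.
rewrite lagrangian_local.
under [X in _ <= X + _]eq_bigr do rewrite rowK.
have -> : \sum_i local_lagrangian f g s delta i (y i) (local xi i) =
    \sum_i local_lagrangian f g s delta i (y i) (local p i) +
    \sum_i \sum_c coord (direction g s delta i (y i)) c *
      (coord (local xi i) c - coord (local p i) c).
  by rewrite -big_split; apply: eq_bigr => i _; exact: local_lagrangian_affine.
rewrite lerD2l.
apply: le_trans (_ : _ <= (T - 1) * (eps / T)) _; last first.
  by rewrite mulrBl mul1r mulrC divfK ?gt_eqF// gerBl divr_ge0// ltW.
rewrite /T addrAC subrr add0r mulr_suml; apply: ler_sum => i _.
rewrite mulr_suml; apply: ler_sum => c _.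
apply: le_trans (ler_norm _) _; rewrite normrM ler_wpM2l//.
by rewrite distrC ltW.
Qed.

Lemma gdual_cluster (R : realType) (N n m : nat) (u : nat -> gdual R N n m) (r : R) :
  (0 < N)%N -> (forall k, Xi (u k)) ->
  (forall k i c, coord (local (u k) i) c <= r) ->
  exists2 p, Xi p & forall (eps : R) K, 0 < eps -> exists2 k, (K <= k)%N &
    forall i c, `|coord (local p i) c - coord (local (u k) i) c| < eps.
Proof.
move=> N0 u0 ur; pose i0 := Ordinal N0.
have u0' k i c : 0 <= coord (local (u k) i) c by move/XiP : (u0 k) => /(_ N0).
have [|q _ qP] := @bounded_cluster R ('I_N * coordT N n m)%type
    (fun k ic => coord (local (u k) ic.1) ic.2) r.
  by move=> k [i c] /=; rewrite ger0_norm.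
have close (eps : R) K : 0 < eps -> exists2 k, (K <= k)%N & forall i c,
    `|coord (local (gdual_of i0 (fun i c => q (i, c))) i) c
        - coord (local (u k) i) c| < eps.
  move=> e0; have [k Kk qk] := qP eps K e0; exists k => // i c.
  rewrite coord_gdual_of /reference; case: ifPn => [shc|_]; last exact: (qk (i, c)).
  by rewrite (consensual_local (u k) shc i i0); exact: (qk (i0, c)).
exists (gdual_of i0 (fun i c => q (i, c))) => //.
apply/XiP => // i c; rewrite leNgt; apply/negP; set a := coord _ _ => a0.
have [|k _ /(_ i c)] := close (- a) 0%N; first by rewrite oppr_gt0.
by rewrite -/a ltr_norml => /andP[+ _]; have := u0' k i c; lra.
Qed.

(** Only the multipliers with [Q 0 <= Q xi] matter, and these are bounded by
    [slater_dual_bound]; a cluster point of a maximizing sequence is a maximizer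
    by upper semicontinuity. *)
Lemma dual_opt_exists (R : realType) (N n m : nat)
    (f : 'I_N -> 'rV[R]_n -> R) (g : 'rV[R]_n -> 'rV[R]_m) (X : set 'rV[R]_n)
    (s : {perm 'I_N}) (delta : R) (zbar : 'rV[R]_n) :
  (0 < N)%N -> (forall i, continuous (f i)) -> continuous g -> compact X ->
  0 < delta -> slater_vector g X zbar ->
  dual_opt f g X s delta !=set0.
Proof.
move=> N0 fc gc Xc d0 zs.
have X0 : X !=set0 by exists zbar; case: zs.
set Q := dual_fun f g X s delta; set r := gamma f g X delta zbar.
have Xi0 : Xi (0 : gdual R N n m).
  by split; apply/mxOverP => i j; rewrite !mxE nnegrE.
have bnd xi : Xi xi -> Q 0 <= Q xi -> forall i c, 0 <= coord (local xi i) c <= r.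
  move=> xi0 le0 i c.
  have x0 j c' : 0 <= coord (local xi j) c' by move/XiP : xi0 => /(_ N0).
  rewrite x0 /=; apply: le_trans (slater_dual_bound fc gc Xc d0 zs xi0 le0 i).
  by rewrite (bigD1 c)//= lerDl sumr_ge0.
(* Restricting to these multipliers makes the maximizing sequence bounded. *)
pose E := [set Q xi | xi in [set xi | Xi xi /\ Q 0 <= Q xi]].
have supE : has_sup E.
  split; first by exists (Q 0); exists 0.
  exists (\sum_i (f i zbar +
    \sum_c `|coord (direction g s delta i zbar) c| * r)) => _ [xi [xi0 le0] <-].
  apply: le_trans (dual_fun_le s delta xi fc gc Xc (fun=> zs.1)) _.
  apply: ler_sum => i _; rewrite local_lagrangianE lerD2l; apply: ler_sum => c _.
  have /andP[c0 cr] := bnd xi xi0 le0 i c.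
  apply: le_trans (ler_norm _) _.
  by rewrite normrM ler_wpM2l// ger0_norm.
have /choice[u uP] : forall k : nat, exists xi, [/\ Xi xi, Q 0 <= Q xi &
    sup E - k.+1%:R^-1 < Q xi].
  move=> k; have [|_ [xi [xi0 le0] <-] h] := @sup_adherent _ E k.+1%:R^-1 _ supE.
    by rewrite invr_gt0.
  by exists xi.
have [||p p0 pP] := @gdual_cluster _ _ _ _ u r N0.
- by move=> k; case: (uP k).
- by move=> k i c; case: (uP k) => a b _; have /andP[] := bnd _ a b i c.
have supQ : sup E <= Q p.
  suff : forall e : R, 0 < e -> sup E <= Q p + e by move/ler_addgt0Pr.
  move=> e e0; have e2 : 0 < e / 2 by rewrite divr_gt0.
  have [eta eta0 etaP] := dual_fun_usc s delta p fc gc Xc X0 e2.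
  pose K := Num.bound (2 / e).
  have [k Kk /etaP] := pP eta K eta0; rewrite -/Q => Qk.
  have [_ _ ltk] := uP k.
  have : (k.+1%:R^-1 : R) <= e / 2.
    rewrite invf_ple ?posrE// invf_div.
    apply: le_trans (ltW (archi_boundP _)) _; first by rewrite divr_ge0// ltW.
    by rewrite ler_nat (leq_trans Kk).
  move: ltk Qk; move: (Q (u k)) (Q p) (sup E) (k.+1%:R^-1) => a1 a2 a3 a4 h1 h2 h3; lra.
exists p; split=> // xi xi0.
apply: le_trans supQ; have [le0|/ltW lt0] := leP (Q 0) (Q xi).
  by apply: sup_upper_bound => //; exists xi.
by apply: le_trans lt0 _; apply: sup_upper_bound => //; exists 0.
Qed.

(** Away from a neighbourhood of its unique minimizer, [h] exceeds its minimum over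
    the compact set [X] by a positive amount. *)
Lemma minimizer_stable (R : realType) (T : topologicalType) (X : set T)
    (h : T -> R) (x : T) (u : nat -> T) :
  compact X -> continuous h -> argmin X h = [set x] ->
  (forall k, X (u k)) ->
  (forall eps : R, 0 < eps -> \forall k \near \oo, h (u k) < h x + eps) ->
  u @ \oo --> x.
Proof.
move=> Xc hc hx Xu hu U; rewrite nbhsE => -[V [oV Vx] VU].
have [Xx hmin] : argmin X h x by rewrite hx.
have Ac : compact (X `&` ~` V) by apply: compact_closedI => //; exact: open_closedC.
have [A0|/set0P A0] := eqVneq (X `&` ~` V) set0.
  exists 0%N => // k _; apply: VU; apply: contrapT => nV.
  by have : (X `&` ~` V) (u k) by []; rewrite A0.
have [c [[Xc' nVc] cmin]] := continuous_min_on_compact A0 Ac hc.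
have hxc : h x < h c.
  rewrite ltNge; apply/negP => le_c; apply: nVc.
  suff : argmin X h c by rewrite hx => ->.
  by split=> // y Xy; apply: le_trans le_c _; exact: hmin.
have := hu (h c - h x); rewrite subr_gt0 => /(_ hxc); apply: filterS => k.
rewrite addrC subrK => ltc; apply: VU; apply: contrapT => nV.
by move: ltc; rewrite ltNge cmin.
Qed.

(** A minimizer for multipliers close to [xi] almost minimizes the Lagrangian at
    [xi], because the directions are uniformly bounded on [X]. *)
Lemma marginal_stable (R : realType) (N n m : nat)
    (f : 'I_N -> 'rV[R]_n -> R) (g : 'rV[R]_n -> 'rV[R]_m) (X : set 'rV[R]_n)
    (s : {perm 'I_N}) (delta : R) (i : 'I_N) (xi : ldual R N n m)
    (x : 'rV[R]_n) (v : nat -> ldual R N n m) (u : nat -> 'rV[R]_n) :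
  (forall i, continuous (f i)) -> continuous g -> compact X ->
  marginal f g X s delta i xi = [set x] ->
  (forall k, marginal f g X s delta i (v k) (u k)) ->
  (forall eps : R, 0 < eps -> \forall k \near \oo, forall c,
    `|coord (v k) c - coord xi c| < eps) ->
  u @ \oo --> x.
Proof.
move=> fc gc Xc mx mu vxi.
have [Xx _] : marginal f g X s delta i xi x by rewrite mx.
apply: (@minimizer_stable R _ X (fun y => local_lagrangian f g s delta i y xi) x u Xc _ mx).
- exact: local_lagrangian_continuous.
- by move=> k; case: (mu k).
move=> eps e0.
have [b b0 bP] := continuous_bounded_on_compact Xc
  (fun c => @coord_direction_continuous R N n m g s delta i c gc).
pose C := #|coordT N n m|%:R * (2 * b) + 1.
have C0 : 0 < C by rewrite ltr_wpDl// mulr_ge0// mulr_ge0// ltW.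
have := vxi (eps / C); rewrite divr_gt0// => /(_ isT); apply: filterS => k vk.
have [Xu uk] := mu k; have := uk x Xx.
rewrite 2!(local_lagrangian_affine _ _ _ _ _ _ xi (v k)).
set D1 := \sum_c _; set D2 := \sum_c _ => le12.
have : D2 - D1 <= #|coordT N n m|%:R * ((2 * b) * (eps / C)).
  rewrite /D1 /D2 -sumrB; under eq_bigr do rewrite -mulrBl.
  apply: sum_dist_le => c; last exact: ltW.
  apply: le_trans (ler_normB _ _) _; have := bP c _ Xu; have := bP c _ Xx; lra.
have : #|coordT N n m|%:R * ((2 * b) * (eps / C)) < eps.
  have -> : #|coordT N n m|%:R * ((2 * b) * (eps / C)) =
    eps * ((C - 1) / C) by rewrite /C; field; rewrite gt_eqF.
  by rewrite gtr_pMr// ltr_pdivrMr// mul1r gtrBl.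
lra.
Qed.

(** * From a unique marginal minimizer to a primal optimum *)

Lemma coord_segment (R : realType) (N n m : nat) (u w : gdual R N n m) (t : R) i c :
  coord (local (u + t *: (w - u)) i) c =
  coord (local u i) c + t * (coord (local w i) c - coord (local u i) c).
Proof. by case: c => [[j|p]|p]; rewrite /= !mxE. Qed.

(** A form of Danskin's theorem.  Let [z k] tend to [xis] along the segment towards
    [xi], with local minimizers [y k].  Optimality of [xis] forces the
    directions at [y k] to make an obtuse angle with [xi - xis]; by stability
    [y k] tends to [x], so the same holds for the directions at [x]. *)
Lemma unique_marginal_saddle (R : realType) (N n m : nat)
    (f : 'I_N -> 'rV[R]_n -> R) (g : 'rV[R]_n -> 'rV[R]_m) (X : set 'rV[R]_n)
    (s : {perm 'I_N}) (delta : R) (xis : gdual R N n m) (x : 'M[R]_(N, n)) :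
  (0 < N)%N -> (forall i, continuous (f i)) -> continuous g -> compact X ->
  dual_opt f g X s delta xis ->
  (forall i, marginal f g X s delta i (local xis i) = [set row i x]) ->
  forall xi, Xi xi -> lagrangian f g s delta x xi <= lagrangian f g s delta x xis.
Proof.
move=> N0 fc gc Xc [xis0 opt] mx xi xi0.
have mx' i : marginal f g X s delta i (local xis i) (row i x) by rewrite mx.
have X0 : X !=set0 by exists (row (Ordinal N0) x); case: (mx' (Ordinal N0)).
pose t k : R := k.+1%:R^-1.
have t0 k : 0 < t k by rewrite invr_gt0.
have t1 k : t k <= 1 by rewrite invf_le1// ler1n.
pose z k := xis + t k *: (xi - xis).
have zE k i c : coord (local (z k) i) c = coord (local xis i) c +
   t k * (coord (local xi i) c - coord (local xis i) c).
  exact: coord_segment.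
have z0 k : Xi (z k).
  apply/XiP => // i c; rewrite zE.
  move/XiP : xi0 => /(_ N0 i c) a0; move/XiP : xis0 => /(_ N0 i c) b0.
  set a := coord _ _ in a0 *; set b := coord _ _ in b0 *.
  have -> : b + t k * (a - b) = (1 - t k) * b + t k * a by ring.
  by apply: addr_ge0; apply: mulr_ge0; rewrite ?subr_ge0 ?(ltW (t0 k)).
have [y ym] : exists y : nat -> 'I_N -> 'rV[R]_n,
    forall k i, marginal f g X s delta i (local (z k) i) (y k i).
  have /choice[y yP] : forall ki : nat * 'I_N, exists y,
      marginal f g X s delta ki.2 (local (z ki.1) ki.2) y.
    by move=> ki; exact: marginal_exists.
  by exists (fun k i => y (k, i)) => k i; exact: (yP (k, i)).
pose D i y c := coord (direction g s delta i y) c.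
pose F k := \sum_i \sum_c D i (y k i) c * (coord (local xi i) c - coord (local xis i) c).
have F0 k : F k <= 0.
  have := opt _ (z0 k).
  rewrite (dual_funE mx') (@dual_funE _ _ _ _ _ _ _ _ _ _ (\matrix_i y k i)); last first.
    by move=> i; rewrite rowK; exact: ym.
  rewrite (lagrangian_affine f g s delta (\matrix_i y k i) xis (z k)) => le1.
  have le2 : lagrangian f g s delta x xis <= lagrangian f g s delta (\matrix_i y k i) xis.
    rewrite -(dual_funE mx') [leRHS]lagrangian_local; apply: dual_fun_le => // i.
    by rewrite rowK; case: (ym k i).
  have E : \sum_i \sum_c coord (direction g s delta i (row i (\matrix_i y k i))) c *
      (coord (local (z k) i) c - coord (local xis i) c) = t k * F k.
    rewrite /F mulr_sumr; apply: eq_bigr => i _; rewrite mulr_sumr rowK.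
    by apply: eq_bigr => c _; rewrite zE /D; ring.
  rewrite E in le1; rewrite -(pmulr_rle0 _ (t0 k)); lra.
have ycvg i : (fun k => y k i) @ \oo --> row i x.
  apply: (marginal_stable fc gc Xc (mx i) (fun k => ym k i)) => eps e0.
  have [b b0 bP] : exists2 b : R, 0 < b & forall c,
      `|coord (local xi i) c - coord (local xis i) c| <= b.
    exists (1 + \sum_c `|coord (local xi i) c - coord (local xis i) c|).
      by rewrite ltr_pwDl// sumr_ge0.
    by move=> c; rewrite (bigD1 c)//= addrCA lerDl addr_ge0// sumr_ge0.
  exists (Num.bound (b / eps)) => // k /= Kk c.
  rewrite zE addrC addKr normrM gtr0_norm//.
  apply: le_lt_trans (ler_wpM2l (ltW (t0 k)) (bP c)) _.
  rewrite mulrC ltr_pdivrMr// -ltr_pdivrMl// mulrC.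
  apply: lt_le_trans (archi_boundP _) _; first by rewrite divr_ge0// ltW.
  by rewrite ler_nat leqW.
have Fcvg : F @ \oo --> \sum_i \sum_c D i (row i x) c *
    (coord (local xi i) c - coord (local xis i) c).
  apply: (@cvg_big R _ +%R 0 xpredT (@add_continuous R)) => i _.
  apply: (@cvg_big R _ +%R 0 xpredT (@add_continuous R)) => c _.
  apply: cvgM; last exact: cvg_cst.
  exact: (@cvg_comp _ _ _ (fun k => y k i) (fun z => D i z c) _ _ _ (ycvg i)
    (@coord_direction_continuous R N n m g s delta i c gc (row i x))).
rewrite (lagrangian_affine f g s delta x xis xi) gerDl.
rewrite -(cvg_lim _ Fcvg)//; apply: limr_le; first by apply/cvg_ex; eexists; exact: Fcvg.
by apply: nearW.
Qed.

(** A linear form bounded above on the nonnegative orthant by its value at a point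
    [M] of it has nonpositive coefficients: increase one entry of [M]. *)
Lemma linear_max_orthant (R : realType) (p q : nat) (V M : 'M[R]_(p, q)) :
  (forall M' : 'M[R]_(p, q), M' \is a mxOver Num.nneg ->
    \sum_i dotp (row i M') (row i V) <= \sum_i dotp (row i M) (row i V)) ->
  M \is a mxOver Num.nneg -> forall i j, V i j <= 0.
Proof.
move=> Mmax /mxOverP M0 i j.
have /Mmax : M + delta_mx i j \is a mxOver Num.nneg.
  by apply/mxOverP => k l; rewrite !mxE nnegrE addr_ge0//; exact: M0.
have -> : \sum_k dotp (row k (M + delta_mx i j)) (row k V) =
    \sum_k dotp (row k M) (row k V) + V i j.
  rewrite -(sum_at i (fun k => V k j)) -big_split; apply: eq_bigr => k _ /=.
  rewrite linearD dotpDl; congr (_ + _).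
  rewrite /dotp (bigD1 j)//= !mxE eqxx andbT big1 ?addr0 => [|l lj].
    by case: eqP => _; rewrite ?mul1r ?mul0r.
  by rewrite !mxE (negbTE lj) andbF mul0r.
by rewrite gerDl.
Qed.

(** Maximality in the multipliers gives feasibility, and comparison with the zero
    multiplier bounds the cost of [x] by the Lagrangian at [xis].  Minimality in
    [x] and the sign of the constraints bound the latter by the cost of any
    feasible point. *)
Lemma saddle_primal_opt (R : realType) (N n m : nat)
    (f : 'I_N -> 'rV[R]_n -> R) (g : 'rV[R]_n -> 'rV[R]_m) (X : set 'rV[R]_n)
    (s : {perm 'I_N}) (delta : R) (xis : gdual R N n m) (x : 'M[R]_(N, n)) :
  Xi xis -> (forall i, X (row i x)) ->
  (forall xi, Xi xi -> lagrangian f g s delta x xi <= lagrangian f g s delta x xis) ->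
  (forall y, (forall i, X (row i y)) ->
    lagrangian f g s delta x xis <= lagrangian f g s delta y xis) ->
  primal_opt f g X s delta x.
Proof.
move=> [mu0 la0 w0] Xx smax smin.
have Lsplit y xi : lagrangian f g s delta y xi = \sum_i f i (row i y) +
    \sum_i dotp (row i xi.1.1) (row i (\matrix_k g (row k y))) +
    \sum_i dotp (row i xi.1.2)
      (row i (\matrix_k (- row k y + row (outn s k) y - Delta delta))) +
    \sum_i dotp (row i xi.2)
      (row i (\matrix_k (row k y - row (outn s k) y - Delta delta))).
  by rewrite /lagrangian !big_split; do ![congr (_ + _)];
    apply: eq_bigr => k _; rewrite rowK.
have zero y : lagrangian f g s delta y 0 = \sum_i f i (row i y).
  have d0 p (V : 'M[R]_(N, p)) : \sum_i dotp (row i (0 : 'M[R]_(N, p))) (row i V) = 0.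
    by rewrite big1// => k _; rewrite /dotp big1// => j _; rewrite !mxE mul0r.
  by rewrite Lsplit !d0 !addr0.
split.
  move=> i; split => // [j|j|j].
  - have := @linear_max_orthant R N m (\matrix_k g (row k x)) xis.1.1 _ mu0 i j.
    rewrite mxE; apply => M M0; have := smax (M, xis.1.2, xis.2).
    by rewrite !Lsplit /= !lerD2r lerD2l; apply.
  - have := @linear_max_orthant R N n
      (\matrix_k (- row k x + row (outn s k) x - Delta delta)) xis.1.2 _ la0 i j.
    rewrite mxE; apply => M M0; have := smax (xis.1.1, M, xis.2).
    by rewrite !Lsplit /= lerD2r lerD2l; apply.
  - have := @linear_max_orthant R N n
      (\matrix_k (row k x - row (outn s k) x - Delta delta)) xis.2 _ w0 i j.
    rewrite mxE; apply => M M0; have := smax (xis.1.1, xis.1.2, M).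
    by rewrite !Lsplit /= lerD2l; apply.
move=> y fy.
rewrite -zero; apply: le_trans (smax 0 _) _.
  by split; apply/mxOverP => i j; rewrite !mxE nnegrE.
apply: le_trans (smin y _) _ => [i|]; first by case: (fy i).
have neg p (M V : 'M[R]_(N, p)) : M \is a mxOver Num.nneg ->
    (forall i, le0v (row i V)) -> \sum_i dotp (row i M) (row i V) <= 0.
  move=> /mxOverP M0 V0; apply: sumr_le0 => i _; apply: sumr_le0 => j _.
  apply: mulr_ge0_le0; last exact: V0.
  by rewrite mxE; exact: M0.
rewrite Lsplit -addrA -addrA gerDl addrA.
by rewrite -[leRHS](addr0 0) -[X in _ <= X + _](addr0 0); apply: lerD; [apply: lerD|];
  apply: neg => // i; rewrite rowK; case: (fy i).
Qed.

(** * Convergence of the iterates *)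

Lemma summable_tail (R : realType) (b : nat -> R) (M eps : R) :
  (forall k, 0 <= b k) -> (forall K, \sum_(k < K) b k <= M) -> 0 < eps ->
  exists K, forall n, \sum_(j < n) b (K + j)%N < eps.
Proof.
move=> b0 bM e0; pose P K := \sum_(k < K) b k.
have hs : has_sup (range P).
  by split; [exists (P 0%N); exists 0%N | exists M => _ [K _ <-]; exact: bM].
have [_ [K _ <-] ltP] := sup_adherent e0 hs.
exists K => n.
have : P (K + n)%N <= sup (range P) by apply: sup_upper_bound => //; exists (K + n)%N.
by rewrite /P big_split_ord /= -/(P K); lra.
Qed.

(** A sequence whose total increase after time [K] is small stays small once it has
    been small after time [K]. *)
Lemma quasi_decreasing_cvg0 (R : realType) (S b : nat -> R) (M : R) :
  (forall k, 0 <= S k) -> (forall k, 0 <= b k) ->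
  (forall K, \sum_(k < K) b k <= M) -> (forall k, S k.+1 <= S k + b k) ->
  (forall (eps : R) K, 0 < eps -> exists2 k, (K <= k)%N & S k < eps) ->
  forall eps : R, 0 < eps -> \forall k \near \oo, S k < eps.
Proof.
move=> S0 b0 bM Sb small eps e0; have e2 : 0 < eps / 2 by rewrite divr_gt0.
have [K tailK] := summable_tail b0 bM e2.
have [k Kk Sk] := small _ K e2.
have Sn n : S (k + n)%N <= S k + \sum_(j < n) b (k + j)%N.
  elim: n => [|n IH]; first by rewrite addn0 big_ord0 addr0.
  rewrite addnS big_ord_recr /= addrA; apply: le_trans (Sb _) _.
  by rewrite lerD2r.
exists k => // l /= kl; rewrite -(subnKC kl).
apply: le_lt_trans (Sn _) _; set n := (l - k)%N.
suff : \sum_(j < n) b (k + j)%N < eps / 2 by lra.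
apply: le_lt_trans (tailK (k - K + n)%N); rewrite big_split_ord /=.
under [X in _ <= _ + X]eq_bigr do rewrite addnA subnKC//.
by rewrite lerDr sumr_ge0.
Qed.

Lemma weighted_gap_small (R : realType) (a gap : nat -> R) (M : R) :
  (forall k, 0 <= a k) -> (forall k, 0 <= gap k) ->
  (forall K, \sum_(k < K) a k * gap k <= M) ->
  (forall T : R, exists K, T < \sum_(k < K) a k) ->
  forall (eps : R) K, 0 < eps -> exists2 k, (K <= k)%N & gap k < eps.
Proof.
move=> a0 g0 gM adiv eps K e0; apply: contrapT => nex.
have ge k : (K <= k)%N -> eps <= gap k.
  by move=> Kk; rewrite leNgt; apply/negP => gk; apply: nex; exists k.
have [L] := adiv (\sum_(k < K) a k + M / eps).
apply/negP; rewrite -leNgt.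
apply: le_trans (_ : _ <= \sum_(k < K + L) a k) _.
  by rewrite addnC big_split_ord /= lerDl sumr_ge0.
rewrite big_split_ord /= lerD2l ler_pdivlMr//.
apply: le_trans (gM (K + L)%N); rewrite big_split_ord /= mulr_suml.
rewrite -[leLHS]add0r lerD//; first by rewrite sumr_ge0// => k _; rewrite mulr_ge0.
by apply: ler_sum => k _; rewrite ler_wpM2l// ge// leq_addr.
Qed.

(** The time index starts at the first iteration of the algorithm: from then on
    the multipliers lie in the projection balls and the [x k i] are local
    minimizers, which may fail for the initial values. *)
Section Iterates.
Variables (R : realType) (N n m : nat).
Variables (f : 'I_N -> 'rV[R]_n -> R) (g : 'rV[R]_n -> 'rV[R]_m).
Variables (X : set 'rV[R]_n) (delta : R) (s : {perm 'I_N}) (A : nat -> 'M[R]_N).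
Variables (zbar : 'rV[R]_n) (theta : 'I_N -> R) (step : nat -> R).
Variables (x : nat -> 'I_N -> 'rV[R]_n) (xi : nat -> 'I_N -> ldual R N n m).
Variables (i0 : 'I_N) (a : R) (B : nat).
Hypothesis f_cont : forall i, continuous (f i).
Hypothesis g_cont : continuous g.
Hypothesis X_compact : compact X.
Hypothesis zbar_slater : slater_vector g X zbar.
Hypothesis delta_gt0 : 0 < delta.
Hypothesis a_gt0 : 0 < a.
Hypothesis A_mixing : forall k, mixing a (A k).
Hypothesis B_gt0 : (0 < B)%N.
Hypothesis A_connected : forall k0, strongly_connected
  [rel j i | [exists k : 'I_B, edge (A (k0 + k)%N) j i]].
Hypothesis theta_gt0 : forall i, 0 < theta i.
Hypothesis step_ge0 : forall k, 0 <= step k.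
Variable sa : R.
Hypothesis step_sqsum : forall K, \sum_(k < K) step k ^+ 2 <= sa.
Hypothesis step_sum : forall T : R, exists K, T < \sum_(k < K) step k.
Hypothesis x_marginal : forall k i,
  marginal f g X s delta i (mix (A k) (xi k) i) (x k i).
Hypothesis xi_bounded : forall k i, dual_ball (gamma f g X delta zbar + theta i) (xi k i).
Hypothesis xi_proj : forall k i,
  is_proj (dual_ball (gamma f g X delta zbar + theta i))
    (mix (A k) (xi k) i + step k *: direction g s delta i (x k i)) (xi k.+1 i).

Local Notation Q := (dual_fun f g X s delta).
Local Notation loc z := (fun i => coord (local z i)).
Let y k i := coord (xi k i).
Let D k i := coord (direction g s delta i (x k i)).
Let zeta k : gdual R N n m := gdual_of i0 (y k).
Let d k := sqdist (y k) (reference shared i0 (y k)).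
Let v k := average shared (A k) (y k).

Let N_gt0 : (0 < N)%N. Proof. exact: leq_ltn_trans (ltn_ord i0). Qed.
Let X_neq0 : X !=set0. Proof. by exists zbar; case: zbar_slater. Qed.

Lemma zeta_Xi k : Xi (zeta k).
Proof.
apply/XiP => // i c; rewrite coord_gdual_of /reference.
by case: ifP => _; [case: (xi_bounded k i0) | case: (xi_bounded k i)] => /Xi'P u0 _;
  exact: u0.
Qed.

Lemma dual_opt_ball z i : dual_opt f g X s delta z ->
  dual_ball (gamma f g X delta zbar + theta i) (local z i).
Proof.
move=> [z0 zmax]; apply: dual_ball_of_sum; first by move/XiP : z0; apply.
have Xi0 : Xi (0 : gdual R N n m).
  by split; apply/mxOverP => ? ?; rewrite !mxE nnegrE.
apply: le_trans (slater_dual_bound f_cont g_cont X_compact delta_gt0 zbar_slater z0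
  (zmax _ Xi0) i) _.
by rewrite lerDl ltW.
Qed.

(** The hypothesis of [projected_step_descent].  The minimizers [h] at the consensual
    point [zeta k] take the place of a Lipschitz estimate of the dual function:
    they test the minimality of [x k i] at the mixed multipliers, and at [zeta k]
    they realise the dual value. *)
Lemma mix_subgradient z k : exists2 h : 'I_N -> 'rV[R]_n, (forall i, X (h i)) &
  \sum_i \sum_c D k i c * (v k i c - loc z i c) <=
    - (Q z - Q (zeta k)) +
    \sum_i \sum_c coord (direction g s delta i (h i)) c *
       (v k i c - reference shared i0 (y k) i c).
Proof.
have /choice[h hm] : forall i, exists h, marginal f g X s delta i (local (zeta k) i) h.
  by move=> i; exact: marginal_exists.
exists h; first by move=> i; case: (hm i).
have Qzeta : Q (zeta k) = \sum_i local_lagrangian f g s delta i (h i) (local (zeta k) i).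
  rewrite (@dual_funE _ _ _ _ _ _ _ _ _ _ (\matrix_i h i)); last first.
    by move=> i; rewrite rowK; exact: hm.
  by rewrite lagrangian_local; apply: eq_bigr => i _; rewrite rowK.
have Qz : Q z <= \sum_i local_lagrangian f g s delta i (x k i) (local z i).
  by apply: dual_fun_le => // i; case: (x_marginal k i).
rewrite opprB; apply: le_trans (_ : _ <= \sum_i (local_lagrangian f g s delta i (h i)
    (mix (A k) (xi k) i) - local_lagrangian f g s delta i (x k i) (local z i))) _.
  apply: ler_sum => i _; have [_ /(_ (h i))] := x_marginal k i.
  have [Xh _] := hm i => /(_ Xh).
  rewrite [X in X <= _ -> _](local_lagrangian_affine _ _ _ _ _ _ (local z i)).
  have -> : \sum_c D k i c * (v k i c - coord (local z i) c) =
     \sum_c coord (direction g s delta i (x k i)) c *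
        (coord (mix (A k) (xi k) i) c - coord (local z i) c).
    by apply: eq_bigr => c _; rewrite coord_mix.
  lra.
have E : \sum_i local_lagrangian f g s delta i (h i) (mix (A k) (xi k) i) =
    Q (zeta k) + \sum_i \sum_c coord (direction g s delta i (h i)) c *
       (v k i c - reference shared i0 (y k) i c).
  rewrite Qzeta -big_split; apply: eq_bigr => i _.
  rewrite (local_lagrangian_affine f g s delta i (h i) (local (zeta k) i)).
  by congr (_ + _); apply: eq_bigr => c _; rewrite coord_mix coord_gdual_of.
rewrite sumrB E; lra.
Qed.

Lemma iterate_descent : exists2 C0 : R, 0 <= C0 &
  (forall k, sqdist (D k) (fun _ _ => 0) <= C0) /\
  forall z k (eps : R), dual_opt f g X s delta z -> 0 < eps ->
  sqdist (y k.+1) (loc z)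
   + (sqdist (y k.+1) (fun i c => v k i c + step k * D k i c)
      + a / (1 + a) * spread shared (A k) (y k)) + 2 * step k * (Q z - Q (zeta k))
  <= sqdist (y k) (loc z) + eps * d k + (C0 / eps + C0) * step k ^+ 2.
Proof.
have [b b0 bP] := @continuous_bounded_on_compact R _ ('I_N * coordT N n m)%type X
  (fun ic x => coord (direction g s delta ic.1 x) ic.2) X_compact
  (fun ic => @coord_direction_continuous R N n m g s delta ic.1 ic.2 g_cont).
pose C0 := (#|'I_N| * #|coordT N n m|)%:R * b ^+ 2.
have C0P (w : 'I_N -> 'rV[R]_n) : (forall i, X (w i)) ->
    sqdist (fun i => coord (direction g s delta i (w i))) (fun _ _ => 0) <= C0.
  move=> Xw; apply: sqdist_le_card => i c; rewrite subr0 -real_normK ?num_real//.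
  by rewrite lerXn2r ?nnegrE ?normr_ge0 ?(ltW b0)//; exact: (bP (i, c)).
exists C0; first by rewrite mulr_ge0// sqr_ge0.
have DC k : sqdist (D k) (fun _ _ => 0) <= C0.
  by apply: C0P => i; case: (x_marginal k i).
split=> // z k eps zopt e0; have [h Xh sub] := mix_subgradient z k.
apply: (projected_step_descent a_gt0 (A_mixing k) (consensual_local z)
  (step_ge0 k) e0 (DC k) (C0P _ Xh) _ sub).
move=> i; have := proj_obtuse (xi_proj k i) (dual_opt_ball i zopt).
have E c : coord (mix (A k) (xi k) i + step k *: direction g s delta i (x k i)) c =
    v k i c + step k * D k i c by rewrite coordD coordZ coord_mix.
under [X in _ + X <= _ -> _]eq_bigr do rewrite E.
by under [X in _ <= X -> _]eq_bigr do rewrite E.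
Qed.

Lemma gap_ge0 z k : dual_opt f g X s delta z -> 0 <= Q z - Q (zeta k).
Proof. by move=> [_ zmax]; rewrite subr_ge0; apply: zmax; exact: zeta_Xi. Qed.

Lemma iterate_summable z : dual_opt f g X s delta z ->
  exists M : R, forall K,
    \sum_(k < K) d k <= M /\ \sum_(k < K) step k * (Q z - Q (zeta k)) <= M.
Proof.
move=> zopt; have [C0 C00 [DC desc]] := iterate_descent.
pose r : R := \sum_i `|gamma f g X delta zbar + theta i|.
have ler_r i (u : ldual R N n m) c :
    dual_ball (gamma f g X delta zbar + theta i) u -> `|coord u c| <= r.
  move=> [_ ur]; apply: le_trans (coord_le_lnorm u c) _; apply: le_trans ur _.
  apply: le_trans (ler_norm _) _.
  by rewrite /r (bigD1 i)//= lerDl sumr_ge0.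
have yr k i c : `|y k i c| <= r by exact: (ler_r i _ c (xi_bounded k i)).
have zr i c : `|loc z i c| <= r by exact: (ler_r i _ c (dual_opt_ball i zopt)).
have sqb (u w : R) : `|u| <= r -> `|w| <= r -> (u - w) ^+ 2 <= (2 * r) ^+ 2.
  move=> ur wr; rewrite -[leLHS]real_normK ?num_real// lerXn2r ?nnegrE//.
    by rewrite mulr_ge0// (le_trans _ ur).
  by apply: le_trans (ler_normB _ _) _; lra.
pose Smax := (#|'I_N| * #|coordT N n m|)%:R * (2 * r) ^+ 2.
pose h k := spread shared (A k) (y k) +
  sqdist (y k.+1) (fun i c => v k i c + step k * D k i c).
have sp0 k : 0 <= spread shared (A k) (y k).
  by apply: spread_ge0; case: (A_mixing k).
have h0 k : 0 <= h k by rewrite addr_ge0// sqdist_ge0.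
pose C1 : R := (N * #|coordT N n m|)%:R * (((N * B.*2.+1) ^ 2)%:R * (3 + a^-1)).
have C10 : 0 <= C1 by rewrite !mulr_ge0// addr_ge0// invr_ge0 ltW.
apply: (@perturbed_descent R (fun k => sqdist (y k) (loc z)) h d step
  (fun k => Q z - Q (zeta k)) (a / (1 + a)) C0 (C1 + 1) Smax Smax sa B) => //.
- by rewrite divr_gt0// addr_gt0.
- by rewrite ltr_wpDl.
- move=> k; rewrite sqdist_ge0 /=; apply: sqdist_le_card => i c.
  exact: sqb (yr _ _ _) (zr _ _).
- move=> k; rewrite sqdist_ge0 /=; apply: sqdist_le_card => i c.
  by apply: sqb => //; rewrite /reference; case: ifP.
- by move=> k; exact: gap_ge0.
- move=> eps k e0; apply: le_trans (desc z k eps zopt e0).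
  rewrite lerD2r lerD2l /h mulrDr [leRHS]addrC lerD2l.
  by rewrite ler_piMl ?sqdist_ge0// ler_pdivrMr ?addr_gt0// mul1r lerDr.
- move=> k; have dw := @disagreement_window R N (coordT N n m) shared a A y D step C0 B k i0
    a_gt0 A_mixing DC (A_connected k).
  apply: le_trans dw _.
  rewrite -/C1 mulrDl mul1r lerDl sumr_ge0// => l _.
  by rewrite addr_ge0// mulr_ge0// sqr_ge0.
Qed.

(** The times [kk j] are chosen so that both the gap and the disagreement are below
    [1 / (j + 1)].  At a cluster point [p] of [zeta (kk j)] the dual value is
    optimal, and the iterates themselves come close to [p] since they are close
    to [zeta]. *)
Lemma dual_convergence : exists2 p : gdual R N n m, dual_opt f g X s delta p &
  forall eps : R, 0 < eps -> \forall k \near \oo, sqdist (y k) (loc p) < eps.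
Proof.
have [z zopt] := dual_opt_exists s N_gt0 f_cont g_cont X_compact delta_gt0 zbar_slater.
have [M MP] := iterate_summable zopt.
have d0 k : 0 <= d k by exact: sqdist_ge0.
have dsmall (eps : R) : 0 < eps -> exists K, forall k, (K <= k)%N -> d k < eps.
  move=> e0; have [K KP] := summable_tail d0 (fun K => (MP K).1) e0.
  exists K => k Kk; apply: le_lt_trans (KP (k - K).+1).
  by rewrite big_ord_recr /= subnKC// lerDr sumr_ge0.
have gsmall := weighted_gap_small step_ge0 (fun k => gap_ge0 k zopt)
  (fun K => (MP K).2) step_sum.
have /choice[kk kkP] : forall j : nat, exists k,
    [/\ (j <= k)%N, Q z - Q (zeta k) < j.+1%:R^-1 & d k < j.+1%:R^-1].
  move=> j; have j0 : 0 < j.+1%:R^-1 :> R by rewrite invr_gt0.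
  have [K KP] := dsmall _ j0.
  have [k] := gsmall _ (maxn j K) j0; rewrite geq_max => /andP[jk Kk] gk.
  by exists k; split=> //; exact: KP.
pose r : R := \sum_i `|gamma f g X delta zbar + theta i|.
have yr k i c : y k i c <= r.
  apply: le_trans (ler_norm _) _; have [_ ur] := xi_bounded k i.
  apply: le_trans (coord_le_lnorm _ c) _; apply: le_trans ur _.
  by apply: le_trans (ler_norm _) _; rewrite /r (bigD1 i)//= lerDl sumr_ge0.
have [||p p0 pP] := @gdual_cluster _ _ _ _ (fun j => zeta (kk j)) r N_gt0.
- by move=> j; exact: zeta_Xi.
- by move=> j i c; rewrite coord_gdual_of /reference; case: ifP.
have small_inv (e : R) : 0 < e -> exists K, forall k, (K <= k)%N -> (k.+1%:R^-1 : R) < e.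
  move=> e0; exists (Num.bound e^-1) => k Kk.
  rewrite invf_plt ?posrE//; apply: lt_le_trans (archi_boundP _) _.
    by rewrite invr_ge0 ltW.
  by rewrite ler_nat leqW.
have zp : Q z <= Q p.
  suff : forall e : R, 0 < e -> Q z <= Q p + e by move/ler_addgt0Pr.
  move=> e e0; have e2 : 0 < e / 2 by rewrite divr_gt0.
  have [eta eta0 etaP] := dual_fun_usc s delta p f_cont g_cont X_compact X_neq0 e2.
  have [K KP] := small_inv _ e2; have [j Kj /etaP] := pP eta K eta0.
  have [_ + _] := kkP j; have := KP j Kj.
  move: (Q z) (Q p) (Q (zeta (kk j))) (j.+1%:R^-1) => q1 q2 q3 q4 h1 h2 h3; lra.
have popt : dual_opt f g X s delta p.
  by split=> // w w0; apply: le_trans zp; case: zopt => _; apply.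
exists p => //.
have [C0 C00 [_ desc]] := iterate_descent.
apply: (@quasi_decreasing_cvg0 _ _ (fun k => d k + (C0 + C0) * step k ^+ 2)
   (M + (C0 + C0) * sa)).
- by move=> k; exact: sqdist_ge0.
- by move=> k; rewrite addr_ge0// mulr_ge0 ?sqr_ge0// addr_ge0.
- move=> K; rewrite big_split /= -mulr_sumr; apply: lerD; first by case: (MP K).
  by apply: ler_wpM2l; [rewrite addr_ge0 | exact: step_sqsum].
- move=> k; have := desc p k 1 popt ltr01; rewrite divr1 mul1r.
  have : 0 <= 2 * step k * (Q p - Q (zeta k)) by rewrite mulr_ge0 ?mulr_ge0 ?gap_ge0.
  have : 0 <= sqdist (y k.+1) (fun i c => v k i c + step k * D k i c) by exact: sqdist_ge0.
  have : 0 <= a / (1 + a) * spread shared (A k) (y k).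
    rewrite mulr_ge0 ?divr_ge0 ?addr_ge0 ?(ltW a_gt0)//.
    by apply: spread_ge0; case: (A_mixing k).
  lra.
move=> eps K e0.
pose C : R := (#|'I_N| * #|coordT N n m|)%:R.
pose eta := eps / (4 * (C + 1)).
have C_ge0 : 0 <= C by [].
have eta0 : 0 < eta by rewrite divr_gt0// mulr_gt0// ltr_wpDl.
have e4 : 0 < eps / 4 by rewrite divr_gt0.
have [K' K'P] := small_inv _ e4.
have sq0 : 0 < Num.sqrt eta by rewrite sqrtr_gt0.
have [j jK jp] := pP (Num.sqrt eta) (maxn K K') sq0.
move: jK; rewrite geq_max => /andP[Kj K'j].
have [jk _ dj] := kkP j.
exists (kk j); first exact: leq_trans jk.
have close : sqdist (reference shared i0 (y (kk j))) (loc p) <= C * eta.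
  apply: sqdist_le_card => i c; have := jp i c; rewrite coord_gdual_of distrC => /ltW.
  rewrite -[X in _ -> _ <= X](sqr_sqrtr (ltW eta0))
    -[X in _ -> X <= _]real_normK ?num_real//.
  by move=> h; rewrite lerXn2r ?nnegrE ?normr_ge0// ltW.
have two : sqdist (y (kk j)) (loc p) <=
    2 * d (kk j) + 2 * sqdist (reference shared i0 (y (kk j))) (loc p).
  rewrite /d /sqdist !mulr_sumr -big_split; apply: ler_sum => i _ /=.
  rewrite !mulr_sumr -big_split; apply: ler_sum => c _ /=.
  set u := y _ _ _; set w := reference _ _ _ _ _; set q := coord _ _.
  rewrite -subr_ge0; have -> : 2 * (u - w) ^+ 2 + 2 * (w - q) ^+ 2 - (u - q) ^+ 2 =
    (u - w - (w - q)) ^+ 2 by ring.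
  exact: sqr_ge0.
have Ceta : C * eta <= eps / 4.
  rewrite /eta mulrA ler_pdivrMr ?mulr_gt0 ?ltr_wpDl// mulrC; lra.
apply: le_lt_trans two _.
have := le_trans close Ceta; have := lt_trans dj (K'P j K'j).
move: (d _) (sqdist _ _) => q1 q2 h1 h2; lra.
Qed.

(** The local minimizers [x k i] are taken at the mixed multipliers, which are at
    least as close to [p] as the iterates, in total squared distance. *)
Lemma primal_convergence p i xh :
  (forall eps : R, 0 < eps -> \forall k \near \oo, sqdist (y k) (loc p) < eps) ->
  marginal f g X s delta i (local p i) = [set xh] ->
  x ^~ i @ \oo --> xh.
Proof.
move=> yp mx; apply: (marginal_stable f_cont g_cont X_compact mx (x_marginal ^~ i)).
move=> eps e0; have := yp (eps ^+ 2); rewrite exprn_gt0// => /(_ isT).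
apply: filterS => k ykp c; rewrite coord_mix.
rewrite -(@ltr_pXn2r _ 2) ?nnegrE ?(ltW e0)// real_normK ?num_real//.
apply: le_lt_trans ykp.
apply: le_trans (sqdist_ge (v k) (loc p) i c) _.
apply: le_trans (average_contraction (y k) a_gt0 (A_mixing k) (consensual_local p)).
rewrite lerDl mulr_ge0 ?divr_ge0 ?addr_ge0 ?(ltW a_gt0)//.
by apply: spread_ge0; case: (A_mixing k).
Qed.

End Iterates.

(** * The convergence theorem *)

Lemma mixing_of_weights (R : realType) (N : nat) (A : nat -> 'M[R]_N) :
  nondegenerate_weights A -> balanced_weights A ->
  exists2 a : R, 0 < a & forall k, mixing a (A k).
Proof.
move=> [a a0 nd] bal; exists a => // k; have [Ar Ac] := bal k; have [dg off] := nd k.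
have ae i j : A k i j = 0 \/ a <= A k i j.
  have [<-|ij] := eqVneq i j; first by right.
  by case: (off i j ij) => [->|/andP[]]; [left | right].
split=> // i j.
- by case: (ae i j) => [->//|]; apply: le_trans; exact: ltW.
- by case: (ae i j) => [->|//]; rewrite eqxx.
Qed.

Lemma norm2_cvg0 (R : realType) (p q : nat) (M : nat -> 'M[R]_(p, q)) (S : nat -> R) :
  (forall eps : R, 0 < eps -> \forall k \near \oo, S k < eps) ->
  (forall k, sqnorm (M k) <= S k) -> norm2 (M k) @[k --> \oo] --> 0.
Proof.
move=> S0 MS; apply/cvgr0Pnorm_lt => eps e0.
have := S0 (eps ^+ 2); rewrite exprn_gt0// => /(_ isT); apply: filterS => k Sk.
rewrite ger0_norm ?sqrtr_ge0// /norm2 -(ger0_norm (ltW e0)) -sqrtr_sqr.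
by rewrite ltr_sqrt ?exprn_gt0//; apply: le_lt_trans Sk.
Qed.

Lemma sqnorm_components (R : realType) (N n m : nat) (u : ldual R N n m) :
  [/\ sqnorm u.1.1 <= \sum_c coord u c ^+ 2, sqnorm u.1.2 <= \sum_c coord u c ^+ 2 &
      sqnorm u.2 <= \sum_c coord u c ^+ 2].
Proof.
have sq0 p q (M : 'M[R]_(p, q)) : 0 <= sqnorm M.
  by rewrite sumr_ge0// => i _; rewrite sumr_ge0// => j _; rewrite sqr_ge0.
have -> : \sum_c coord u c ^+ 2 = sqnorm u.1.1 + sqnorm u.1.2 + sqnorm u.2.
  by rewrite big_coord /sqnorm big_ord1.
have := sq0 _ _ u.1.1; have := sq0 _ _ u.1.2; have := sq0 _ _ u.2.
by move=> h1 h2 h3; split; lra.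
Qed.

Lemma sqnorm_cvg0 (R : realType) (n : nat) (u : nat -> 'rV[R]_n) (x : 'rV[R]_n) :
  u @ \oo --> x -> forall eps : R, 0 < eps -> \forall k \near \oo, sqnorm (u k - x) < eps.
Proof.
move=> ux eps e0.
have : sqnorm (u k - x) @[k --> \oo] --> \sum_(i < 1) \sum_(j < n) (0 : R) ^+ 2.
  apply: (@cvg_big R _ +%R 0 xpredT (@add_continuous R)) => i _.
  apply: (@cvg_big R _ +%R 0 xpredT (@add_continuous R)) => j _.
  have uij : u k i j @[k --> \oo] --> x i j.
    exact: (@cvg_comp _ _ _ u (fun M : 'rV[R]_n => M i j) _ _ _ ux
      (@coord_continuous R 1 n i j x)).
  have -> : (fun k => (u k - x) i j ^+ 2) =
      (fun k => (u k i j - x i j) * (u k i j - x i j)).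
    by apply/funext => k; rewrite !mxE expr2.
  have d0 : (u k i j - x i j) @[k --> \oo] --> (0 : R).
    by rewrite -(subrr (x i j)); apply: cvgB => //; exact: cvg_cst.
  by rewrite expr2; apply: cvgM.
rewrite big1 => [|i _]; last by rewrite big1// => j _; rewrite expr0n.
move=> /cvgr0Pnorm_lt /(_ eps e0); apply: filterS => k.
by apply: le_lt_trans; exact: ler_norm.
Qed.

Theorem mainTheorem1 (R : realType) (N n m : nat)
  (f : 'I_N -> 'rV[R]_n -> R) (g : 'rV[R]_n -> 'rV[R]_m)
  (X : set 'rV[R]_n) (delta : R) (s : {perm 'I_N}) (A : nat -> 'M[R]_N)
  (zbar : 'rV[R]_n) (theta : 'I_N -> R) (step : nat -> R)
  (x : nat -> 'I_N -> 'rV[R]_n) (xi : nat -> 'I_N -> ldual R N n m)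
  (N_gt0 : (0 < N)%N)
  (f_cont : forall i, continuous (f i))
  (g_cont : continuous g)
  (X_compact : compact X)
  (P_feasible : feasible g X !=set0)
  (zbar_slater : slater_vector g X zbar)
  (delta_gt0 : 0 < delta)
  (s_cycle : is_cycle s)
  (A_nondegenerate : nondegenerate_weights A)
  (A_balanced : balanced_weights A)
  (A_connected : periodically_connected A)
  (theta_gt0 : forall i, 0 < theta i)
  (step_ge0 : forall k, 0 <= step k)
  (step_cvg0 : step k @[k --> \oo] --> 0)
  (step_sum : series step k @[k --> \oo] --> +oo)
  (step_sqsum : cvgn (series (fun k => step k ^+ 2)))
  (x_xi_DADS : DADS f g X s delta A zbar theta step x xi) :
  exists2 xistar : gdual R N n m,
    dual_opt f g X s delta xistar /\
    (forall i : 'I_N,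
      [/\ norm2 ((xi k i).1.1 - row i xistar.1.1) @[k --> \oo] --> 0,
          norm2 ((xi k i).1.2 - xistar.1.2) @[k --> \oo] --> 0 &
          norm2 ((xi k i).2 - xistar.2) @[k --> \oo] --> 0]) &
    (dual_single f g X s delta xistar ->
     exists2 xstar : 'M[R]_(N, n),
       primal_opt f g X s delta xstar &
       forall i : 'I_N,
         norm2 (x k i - row i xstar) @[k --> \oo] --> 0).
Proof.
have [_ _ xm xp] := x_xi_DADS.
have [a a0 mA] := mixing_of_weights A_nondegenerate A_balanced.
have [B B0 conn] := A_connected.
pose i0 := Ordinal N_gt0.
have sq_le K : \sum_(k < K) step k.+1 ^+ 2 <= limn (series (fun k => step k ^+ 2)).
  apply: le_trans (_ : _ <= series (fun k => step k ^+ 2) K.+1) _.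
    by rewrite /series /= big_mkord big_ord_recl /= lerDr sqr_ge0.
  apply: nondecreasing_cvgn_le => //.
  by apply: nondecreasing_series => k _ _; rewrite sqr_ge0.
have sum_inf (T : R) : exists K, T < \sum_(k < K) step k.+1.
  move/cvgryPge : step_sum => /(_ (T + 1 + step 0%N)) [K _ /(_ K.+1 (leqnSn K))].
  rewrite /series /= big_mkord big_ord_recl /= => h; exists K.
  by move: h; rewrite addrC lerD2l; apply: lt_le_trans; rewrite ltrDl.
have conn' k0 : strongly_connected
    [rel j i | [exists k : 'I_B, edge (A (k0 + k).+1) j i]].
  exact: (conn k0.+1).
have xib k i : dual_ball (gamma f g X delta zbar + theta i) (xi k.+1 i).
  by case: (xp k i).
have [p popt yp] := @dual_convergence R N n m f g X delta s (fun k => A k.+1) zbar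
  theta (fun k => step k.+1) (fun k => x k.+1) (fun k => xi k.+1) i0 a B
  f_cont g_cont X_compact zbar_slater delta_gt0 a0 (fun k => mA k.+1) B0 conn'
  theta_gt0 (fun k => step_ge0 k.+1) _ sq_le sum_inf (fun k i => xm k.+1 i (ltn0Sn k))
  xib (fun k i => xp k.+1 i).
exists p.
  split=> // i.
  have le1 k : \sum_c coord (xi k.+1 i - local p i) c ^+ 2 <=
      sqdist (fun i => coord (xi k.+1 i)) (fun i => coord (local p i)).
    rewrite /sqdist (bigD1 i)//=; under eq_bigr do rewrite coordB.
    by rewrite lerDl sumr_ge0// => j _; rewrite sumr_ge0// => c _; rewrite sqr_ge0.
  have comp k := sqnorm_components (xi k.+1 i - local p i).
  split; rewrite -cvg_shiftS; apply: (norm2_cvg0 yp) => k;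
    apply: le_trans (le1 k); by case: (comp k).
move=> /choice[xh xhP].
have xhE : forall i, marginal f g X s delta i (local p i) = [set row i (\matrix_i xh i)].
  by move=> i; rewrite rowK; exact: xhP.
have mrow i : marginal f g X s delta i (local p i) (row i (\matrix_i xh i)).
  by rewrite xhE.
exists (\matrix_i xh i).
  apply: (@saddle_primal_opt _ _ _ _ _ _ _ _ _ p); first by case: popt.
  - by move=> i; case: (mrow i).
  - exact: (unique_marginal_saddle N_gt0 f_cont g_cont X_compact popt xhE).
  - move=> y Xy; rewrite -(dual_funE mrow) [leRHS]lagrangian_local.
    exact: dual_fun_le.
move=> i; rewrite rowK -cvg_shiftS.
apply: (@norm2_cvg0 _ _ _ _ (fun k => sqnorm (x k.+1 i - xh i))) => //.
apply: sqnorm_cvg0.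
exact: (@primal_convergence R N n m f g X delta s (fun k => A k.+1)
  (fun k => x k.+1) (fun k => xi k.+1) a f_cont g_cont X_compact a0
  (fun k => mA k.+1) (fun k i => xm k.+1 i (ltn0Sn k)) p i (xh i) yp (xhP i)).
Qed.
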